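(* There is an algorithm which, given any symmetric fair division instance with $n$ agents having $\mathsf{SPLC}$ valuations (specified by the number of types $t$, the numbers of copies $(k_j)_{j\in[t]}$ and the values $v_{ijk}$), outputs in polynomial time an allocation $(A_1,\dots,A_n)$ of the goods such that $v_i(A_i)\ge \frac12 \mathsf{MMS}_i$ for every agent $i\in[n]$.
   Context: There are $n$ agents with equal entitlements $1/n$. $\mathsf{SPLC}$ (separable piecewise-linear concave) valuations: there are $t$ types of goods, type $j\in[t]$ having $k_j$ identical copies; $\mathcal M$ is the set of all copies of all goods and $\mathcal M_j\subseteq\mathcal M$ is the set of copies of good $j$. Agent $i$ has values $v_{ij1}\ge v_{ij2}\ge\dots\ge v_{ijk_j}\ge 0$ for each $j\in[t]$, and $v_i(S)=\sum_{j\in[t]}\sum_{k\le |S\cap\mathcal M_j|}v_{ijk}$ for $S\subseteq\mathcal M$. An allocation is a partition $(A_1,\dots,A_n)$ of $\mathcal M$ (empty parts allowed); $\Pi_{[n]}(\mathcal M)$ is the set of all allocations. The maximin share of agent $i$ is $\mathsf{MMS}_i=\max_{(A_1,\dots,A_n)\in\Pi_{[n]}(\mathcal M)}\min_{k\in[n]}v_i(A_k)$. *)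

(* Defs.v *)
From mathcomp Require Import all_boot all_order all_algebra.

Set Implicit Arguments.
Unset Strict Implicit.
Unset Printing Implicit Defensive.

Import Order.TTheory GRing.Theory Num.Theory.

Local Open Scope ring_scope.

(* The values are rational since they are part of the input of an algorithm.
   Agents, types and copies are numbered from 0: [value i j c] is the paper's
   v_{i,j,c+1}; it is irrelevant, and not part of the input, unless
   c < copies j. *)
Record splc_instance := SplcInstance {
  agents : nat;
  types : nat;
  copies : 'I_types -> nat;
  value : 'I_agents -> 'I_types -> nat -> rat;
  agents_gt0 : (0 < agents)%N;
  value_ge0 : forall i j c, (c < copies j)%N -> 0 <= value i j c;
  value_noninc : forall i j c c',
    (c <= c')%N -> (c' < copies j)%N -> value i j c' <= value i j c
}.

Section FairDivision.

Variable I : splc_instance.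

Definition good : finType := {j : 'I_(types I) & 'I_(copies j)}.

Definition goods_of_type (j : 'I_(types I)) : {set good} :=
  [set g : good | tag g == j].

Definition valuation (i : 'I_(agents I)) (S : {set good}) : rat :=
  \sum_(j < types I) \sum_(c < #|S :&: goods_of_type j|) value i j c.

(* [finset.partition] is not used because it forbids empty parts. *)
Definition is_allocation (A : {ffun 'I_(agents I) -> {set good}}) : bool :=
  [forall i, forall i', (i != i') ==> [disjoint A i & A i']]
  && (\bigcup_i A i == [set: good]).

(* The default values of the two iterated operators are harmless: there is at
   least one agent and one allocation, and valuations lie between 0 and the
   value of the set of all goods. *)
Definition mms (i : 'I_(agents I)) : rat :=
  \big[Num.max/0]_(A : {ffun 'I_(agents I) -> {set good}} | is_allocation A)
    \big[Num.min/valuation i [set: good]]_(k < agents I) valuation i (A k).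

End FairDivision.

(* Model of computation: structured random access machine programs under the
   logarithmic cost criterion, which is polynomially equivalent to Turing
   machines. The memory consists of arrays of unbounded natural numbers, the
   arrays being named by natural numbers that are fixed in the program. *)
Inductive binop := Add | Sub | Mul | Div.

Inductive expr :=
  | Const of nat
  | Get of nat & expr
  | Op of binop & expr & expr.

Inductive cmd :=
  | Skip
  | Assign of nat & expr & expr
  | Seq of cmd & cmd
  | If of expr & cmd & cmd
  | While of expr & cmd.

Definition state := nat -> nat -> nat.

Definition update (s : state) (x a v : nat) : state :=
  fun y b => if (y == x) && (b == a) then v else s y b.

(* [Sub] is truncated, and [Div] by 0 yields 0. *)
Definition eval_op (o : binop) : nat -> nat -> nat :=
  match o with Add => addn | Sub => subn | Mul => muln | Div => divn end.

Fixpoint eval (s : state) (e : expr) : nat :=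
  match e with
  | Const n => n
  | Get x a => s x (eval s a)
  | Op o e1 e2 => eval_op o (eval s e1) (eval s e2)
  end.

Definition bitlen (n : nat) : nat := (trunc_log 2 n).+1.

Fixpoint cost (s : state) (e : expr) : nat :=
  (bitlen (eval s e) +
   match e with
   | Const _ => 0
   | Get _ a => cost s a
   | Op _ e1 e2 => cost s e1 + cost s e2
   end)%N.

(* [exec p s T s']: started in memory s, the program p halts in memory s'
   after time T. A test succeeds when its value is nonzero. *)
Inductive exec : cmd -> state -> nat -> state -> Prop :=
  | ExecSkip s : exec Skip s 1%N s
  | ExecAssign s x a e :
      exec (Assign x a e) s (cost s a + cost s e)%N
           (update s x (eval s a) (eval s e))
  | ExecSeq p q s s' s'' T T' :
      exec p s T s' -> exec q s' T' s'' -> exec (Seq p q) s (T + T')%N s''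
  | ExecIfTrue e p q s s' T :
      eval s e != 0%N -> exec p s T s' -> exec (If e p q) s (cost s e + T)%N s'
  | ExecIfFalse e p q s s' T :
      eval s e = 0%N -> exec q s T s' -> exec (If e p q) s (cost s e + T)%N s'
  | ExecWhileTrue e p s s' s'' T T' :
      eval s e != 0%N -> exec p s T s' -> exec (While e p) s' T' s'' ->
      exec (While e p) s (cost s e + T + T')%N s''
  | ExecWhileFalse e p s :
      eval s e = 0%N -> exec (While e p) s (cost s e) s.

Section InputOutput.

Variable I : splc_instance.

Definition value_list : seq rat :=
  flatten [seq [seq value i j c | j <- enum 'I_(types I), c <- iota 0 (copies j)]
          | i <- enum 'I_(agents I)].

Definition input : seq (seq nat) :=
  [:: [:: agents I; types I];
      [seq copies j | j <- enum 'I_(types I)];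
      [seq `|numq q|%N | q <- value_list];
      [seq `|denq q|%N | q <- value_list]].

Definition input_size : nat := (\sum_(r <- input) \sum_(m <- r) bitlen m)%N.

Definition input_state : state := fun x a => nth 0%N (nth [::] input x) a.

(* The goods are listed type by type; array 4 contains the agent that receives
   each of them. *)
Definition good_index (g : good I) : nat :=
  flatten_index [seq copies j | j <- enum 'I_(types I)] (tag g) (tagged g).

Definition output (s : state) : {ffun 'I_(agents I) -> {set good I}} :=
  [ffun i : 'I_(agents I) => [set g | s 4%N (good_index g) == i :> nat]].

End InputOutput.

(* Main.v *)
Require Import Defs.
From mathcomp Require Import all_boot all_order all_algebra.
From mathcomp Require Import zify.

Set Implicit Arguments.
Unset Strict Implicit.
Unset Printing Implicit Defensive.

Import Order.TTheory GRing.Theory Num.Theory.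

(* Let agent [i] value the [c]-th remaining copy of type [j], for [m] remaining
   agents, at [v_ij(c / m)]. The sum [U_i] of these values is the largest total
   value of a distribution of the goods among [m] copies of agent [i], so
   [U_i >= m MMS_i], and any bundle worth at least [U_i / 2m] is good enough.

   As long as some agent accepts a single good at this price, she leaves with
   it; this does not decrease the maximin shares of the others, because deleting
   the part that contains that good leaves a partition for one agent fewer.
   Afterwards single goods are worth less than [U_i / 2m] to everybody. The next
   bundle then starts with [floor (k_j / m)] copies of each type and is extended
   type by type to [ceil (k_j / m)] copies until some agent accepts it. The full
   bundle is worth at least [U_i / m] to every agent, so this happens. The others
   value the accepted bundle at [U_i / m] at most: they rejected it before the
   last good was added, and that good is small. Since it is balanced, removing
   it lowers [U_i] by at most its value, so [U_i / m] does not decrease.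

   The program multiplies all values by the product of the denominators, so as
   to compute with integers. If there are no goods it skips the main loop, since
   the number of agents can then be exponential in the size of the input. *)

(** * Time-bounded total correctness *)

(** Chosen so that [e] evaluates to less than [2 ^ (w * bit_weight e)] when all cells are below
    [2 ^ w] and [w] is positive. Weights add because bit lengths add under multiplication. *)
Fixpoint bit_weight (e : expr) : nat :=
  match e with
  | Const n => n.+1
  | Get _ a => (bit_weight a).+1
  | Op _ e1 e2 => bit_weight e1 + bit_weight e2
  end.

Fixpoint cost_weight (e : expr) : nat :=
  bit_weight e +
  match e with
  | Const _ => 0
  | Get _ a => cost_weight a
  | Op _ e1 e2 => cost_weight e1 + cost_weight e2
  end.

(* Running time of a program all of whose loops make at most [N] iterations
   and all of whose memory cells stay below [2 ^ w]. *)
Fixpoint time_bound (N w : nat) (p : cmd) : nat :=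
  match p with
  | Skip => 1
  | Assign _ a e => w * (cost_weight a + cost_weight e)
  | Seq p q => time_bound N w p + time_bound N w q
  | If e p q => w * cost_weight e + (time_bound N w p + time_bound N w q)
  | While e p => N.+1 * (w * cost_weight e + time_bound N w p)
  end.

(** For a fixed program the bound is built from [N] and [w] by sums and products. As [l.+1] is
    positive, degrees may simply be added, even for a sum. *)
Lemma time_bound_poly (N w : nat -> nat) (aN dN aw dw : nat) (p : cmd) :
    (forall l, N l <= aN * l.+1 ^ dN) -> (forall l, w l <= aw * l.+1 ^ dw) ->
  exists a d, forall l, time_bound (N l) (w l) p <= a * l.+1 ^ d.
Proof.
move=> hN hw.
have mono l d d' : d <= d' -> l.+1 ^ d <= l.+1 ^ d'.
  by move=> h; rewrite leq_pexp2l.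
have hwc c l : w l * c <= aw * c * l.+1 ^ dw.
  by rewrite mulnAC leq_mul2r hw orbT.
have add a1 d1 a2 d2 x y l : x <= a1 * l.+1 ^ d1 -> y <= a2 * l.+1 ^ d2 ->
    x + y <= (a1 + a2) * l.+1 ^ (d1 + d2).
  move=> h1 h2; rewrite mulnDl leq_add //.
    by apply: (leq_trans h1); rewrite leq_mul2l mono ?orbT ?leq_addr.
  by apply: (leq_trans h2); rewrite leq_mul2l mono ?orbT ?leq_addl.
elim: p => [|x a e|p [a1 [d1 h1]] q [a2 [d2 h2]]
           |e p [a1 [d1 h1]] q [a2 [d2 h2]]|e p [a1 [d1 h1]]] /=.
- by exists 1, 0.
- by exists (aw * (cost_weight a + cost_weight e)), dw => l; apply: hwc.
- by exists (a1 + a2), (d1 + d2) => l; apply: add.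
- exists (aw * cost_weight e + (a1 + a2)), (dw + (d1 + d2)) => l.
  by apply: (add); [exact: hwc | exact: add].
- exists (aN.+1 * (aw * cost_weight e + a1)), (dN + (dw + d1)) => l.
  rewrite expnD mulnACA; apply: leq_mul; last by apply: add; [exact: hwc | exact: h1].
  by rewrite mulSn -[(N l).+1]add1n leq_add ?hN ?expn_gt0.
Qed.

Section Correctness.

Variables N w : nat.

Definition bounded (s : state) := forall x a, s x a < 2 ^ w.

(** Boundedness is assumed before and ensured after the run, so that specifications compose and
    every evaluation has a bounded cost. *)
Definition ok (p : cmd) (s : state) (Q : state -> Prop) : Prop :=
  bounded s -> exists T s',
    [/\ exec p s T s', T <= time_bound N w p, bounded s' & Q s'].

Hypothesis w_gt0 : 0 < w.

Lemma eval_lt s e : bounded s -> eval s e < 2 ^ (w * bit_weight e).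
Proof.
move=> hs; have pos e' : 0 < w * bit_weight e'.
  by rewrite muln_gt0 w_gt0; elim: e' => //= _ e1 h1 e2 h2; rewrite addn_gt0 h1.
elim: e => [n|x a _|o e1 h1 e2 h2] /=.
- by rewrite (@leq_trans (2 ^ n.+1)) ?leq_exp2l ?leq_pmull // ltnW // ltn_expl.
- by rewrite (leq_trans (hs _ _)) // leq_exp2l // leq_pmulr.
have h12 : 2 ^ (w * (bit_weight e1 + bit_weight e2)) =
    2 ^ (w * bit_weight e1) * 2 ^ (w * bit_weight e2).
  by rewrite mulnDr expnD.
(* Both factors are at least 2, so their product also dominates the sum of two numbers below
   them. *)
have g1 : 1 < 2 ^ (w * bit_weight e1) by rewrite -{1}(expn0 2) ltn_exp2l.
have g2 : 1 < 2 ^ (w * bit_weight e2) by rewrite -{1}(expn0 2) ltn_exp2l.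
rewrite h12; case: o => /=.
- by nia.
- by nia.
- exact: ltn_mul.
- by have := leq_div (eval s e1) (eval s e2); nia.
Qed.

Lemma bitlen_eval s e : bounded s -> bitlen (eval s e) <= w * bit_weight e.
Proof.
move=> hs; rewrite /bitlen; have := eval_lt e hs.
case: (eval s e) => [_|k hk].
  rewrite trunc_log0 muln_gt0 w_gt0.
  by elim: e => //= _ e1 h1 e2 h2; rewrite addn_gt0 h1.
rewrite -(@ltn_exp2l 2) //.
by apply: leq_ltn_trans hk; apply: trunc_logP.
Qed.

Lemma cost_le s e : bounded s -> cost s e <= w * cost_weight e.
Proof.
move=> hs; elim: e => [n|x a h|o e1 h1 e2 h2]; rewrite /= mulnDr.
- by rewrite leq_add // ?(bitlen_eval (Const n) hs).
- by rewrite leq_add // (bitlen_eval (Get x a) hs).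
- by rewrite leq_add ?(bitlen_eval (Op o e1 e2) hs) // mulnDr leq_add.
Qed.

Lemma ok_weaken p s (Q Q' : state -> Prop) :
  (forall s', Q' s' -> Q s') -> ok p s Q' -> ok p s Q.
Proof.
move=> h hp hs; have [T [s' [h1 h2 h3 h4]]] := hp hs.
by exists T, s'; split=> //; apply: h.
Qed.

Lemma ok_skip s (Q : state -> Prop) : Q s -> ok Skip s Q.
Proof. by move=> h hs; exists 1, s; split=> //; apply: ExecSkip. Qed.

Lemma ok_assign x a e s (Q : state -> Prop) :
  eval s e < 2 ^ w -> Q (update s x (eval s a) (eval s e)) ->
  ok (Assign x a e) s Q.
Proof.
move=> he hQ hs; exists (cost s a + cost s e), (update s x (eval s a) (eval s e)).
split=> //; first exact: ExecAssign.
  by rewrite /= mulnDr leq_add // cost_le.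
by move=> y b; rewrite /update; case: ifP => // _; apply: hs.
Qed.

Lemma ok_seq p q s Q : ok p s (fun s' => ok q s' Q) -> ok (Seq p q) s Q.
Proof.
move=> h hs; have [T [s' [h1 h2 h3 h4]]] := h hs.
have [T' [s'' [k1 k2 k3 k4]]] := h4 h3.
exists (T + T'), s''; split=> //; first exact: ExecSeq h1 k1.
by rewrite /= leq_add.
Qed.

Lemma ok_if e p q s Q :
    (eval s e != 0 -> ok p s Q) -> (eval s e = 0 -> ok q s Q) ->
  ok (If e p q) s Q.
Proof.
move=> hp hq hs; have hc := cost_le e hs.
have [e0|e1] := eqVneq (eval s e) 0.
  have [T [s' [h1 h2 h3 h4]]] := hq e0 hs.
  exists (cost s e + T), s'; split=> //; first exact: ExecIfFalse.
  by rewrite /= leq_add // (leq_trans h2) ?leq_addl.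
have [T [s' [h1 h2 h3 h4]]] := hp e1 hs.
exists (cost s e + T), s'; split=> //; first exact: ExecIfTrue.
by rewrite /= leq_add // (leq_trans h2) ?leq_addr.
Qed.

(** The index of [Inv] is a decreasing variant. The time bound is first proved with the variant in
    place of [N], by strong induction: [v] iterations make [v.+1] tests. *)
Lemma ok_while (Inv : nat -> state -> Prop) e p v s (Q : state -> Prop) :
    Inv v s -> v <= N ->
    (forall v s, Inv v s -> eval s e != 0 ->
       ok p s (fun s' => exists2 v', v' < v & Inv v' s')) ->
    (forall v s, Inv v s -> eval s e = 0 -> Q s) ->
  ok (While e p) s Q.
Proof.
move=> hI hv hbody hQ hs.
suff [T [s' [h1 h2 h3 h4]]] : exists T s', [/\ exec (While e p) s T s',
    T <= v.+1 * (w * cost_weight e + time_bound N w p), bounded s' & Q s'].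
  exists T, s'; split=> //; apply: (leq_trans h2).
  by rewrite /= leq_mul2r ltnS hv orbT.
elim/ltn_ind: v s hI {hv} hs => v IH s hI hs; have hc := cost_le e hs.
have [e0|e1] := eqVneq (eval s e) 0.
  exists (cost s e), s; split=> //; first exact: ExecWhileFalse.
    by rewrite mulSn -addnA (leq_trans hc) ?leq_addr.
  exact: hQ hI e0.
have [T [s' [h1 h2 h3 [v' hv' hI']]]] := hbody _ _ hI e1 hs.
have [T' [s'' [k1 k2 k3 k4]]] := IH _ hv' _ hI' h3.
exists (cost s e + T + T'), s''; split=> //; first exact: ExecWhileTrue h1 k1.
rewrite mulSn leq_add ?leq_add // (leq_trans k2) //.
by rewrite leq_mul2r hv' orbT.
Qed.

End Correctness.

Notation var x := (Get x (Const 0)).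
Notation setvar x e := (Assign x (Const 0) e).
Notation For x e p :=
  (Seq (setvar x (Const 0))
       (While (Op Defs.Sub e (var x)) (Seq p (setvar x (Op Defs.Add (var x) (Const 1)))))).

(** The limit [e] is evaluated anew at each test, so the invariant has to fix its value. The body
    must preserve the counter, and the invariant is restored after the increment. *)
Lemma ok_for N w (Inv : nat -> state -> Prop) x e p n s (Q : state -> Prop) :
    0 < w -> n <= N -> n < 2 ^ w ->
    Inv 0 (update s x 0 0) ->
    (forall i s', i <= n -> s' x 0 = i -> Inv i s' -> eval s' e = n) ->
    (forall i s', i < n -> s' x 0 = i -> Inv i s' ->
       ok N w p s' (fun s'' => s'' x 0 = i /\ Inv i.+1 (update s'' x 0 i.+1))) ->
    (forall s', s' x 0 = n -> Inv n s' -> Q s') ->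
  ok N w (For x e p) s Q.
Proof.
move=> w0 nN nw h0 he hp hQ; apply: ok_seq; apply: ok_assign => //=.
  by rewrite expn_gt0.
pose J v s' := exists i, [/\ i + v = n, s' x 0 = i & Inv i s'].
apply: (@ok_while _ _ w0 J _ _ n) => //.
- by exists 0; split=> //; rewrite /update !eqxx.
- move=> v s' [i [iv si hi]] /=; rewrite si (he i) //; last by rewrite -iv leq_addr.
  rewrite -lt0n subn_gt0 => lt_in; apply: ok_seq.
  apply: ok_weaken (hp _ _ lt_in si hi) => s'' [si' hi'].
  apply: ok_assign => //=; rewrite si' addn1; first exact: leq_ltn_trans nw.
  exists v.-1; first by lia.
  by exists i.+1; split; rewrite ?/update ?eqxx //; lia.
- move=> v s' [i [iv si hi]] /=; rewrite si (he i) //; last by rewrite -iv leq_addr.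
  move=> hin; have {}hin : i = n by lia.
  by rewrite hin in si hi; apply: hQ.
Qed.
(** * Balanced distributions *)

Section Profile.

Variable V : nat -> nat.
Hypothesis V_noninc : forall c c', c <= c' -> V c' <= V c.

Definition balanced (m k : nat) : nat := \sum_(c < k) V (c %/ m).

(* Passing from [k] to [k + 1] replaces the summand [l = 0] by one with index
   [k / m + 1]. *)
Lemma balancedE m k : 0 < m ->
  balanced m k = \sum_(l < m) \sum_(c < (k + l) %/ m) V c.
Proof.
case: m => // m _; rewrite /balanced; elim: k => [|k IH].
  rewrite big_ord0 big1 // => l _; rewrite add0n divn_small //.
  by rewrite big_ord0.
rewrite big_ord_recr /= IH big_ord_recl addn0 [RHS]big_ord_recr /=.
rewrite (_ : (k.+1 + m) %/ m.+1 = (k %/ m.+1).+1).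
  rewrite big_ord_recr /=.
  under [X in _ + X + _]eq_bigr => l _ do rewrite /bump add1n -addSnnS.
  lia.
by rewrite addSnnS divnDr ?divnn ?addn1.
Qed.

(* By pigeonhole some part has more than [k / m] copies; take away its last. *)
Lemma alloc_le_balanced m k (a : 'I_m -> nat) : \sum_l a l <= k ->
  \sum_l \sum_(c < a l) V c <= balanced m k.
Proof.
elim: k a => [|k IH] a ha.
  rewrite big1 // => l _; rewrite (_ : a l = 0) ?big_ord0 //.
  by move: ha; rewrite (bigD1 l) //=; case: (a l).
rewrite /balanced big_ord_recr /=.
have [hk|hk] := leqP (\sum_l a l) k.
  by rewrite (leq_trans (IH _ hk)) ?leq_addr.
have [l hl] : exists l, k %/ m < a l.
  apply/existsP/contraT => /existsPn h.
  suff : \sum_l a l <= k by lia.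
  apply: (@leq_trans (\sum_(l < m) k %/ m)).
    by apply: leq_sum => l _; rewrite leqNgt h.
  by rewrite sum_nat_const card_ord mulnC leq_divM.
pose a' l' := if l' == l then (a l).-1 else a l'.
have e (F : nat -> nat) : \sum_(l' | l' != l) F (a' l') = \sum_(l' | l' != l) F (a l').
  by apply: eq_bigr => l' /negPf; rewrite /a' => ->.
have ha' : \sum_l a' l <= k.
  move: ha; rewrite (bigD1 l) //= [X in _ -> is_true (X <= _)](bigD1 l) //=.
  by rewrite (e id) {1}/a' eqxx /=; case: (a l) hl => // b _.
apply: leq_trans (leq_add (IH _ ha') (leqnn _)).
rewrite (bigD1 l) //= [X in _ <= X + _](bigD1 l) //=.
rewrite (e (fun b => \sum_(c < b) V c)).
rewrite (_ : a' l = (a l).-1); last by rewrite /a' eqxx.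
case: (a l) hl => // b hb; rewrite big_ord_recr /= addnAC leq_add2l.
exact: V_noninc.
Qed.

(** Giving [k %/ m] copies to each of [m] parts is one of the distributions covered by
    [alloc_le_balanced]. *)
Lemma balanced_floor m k : m * \sum_(c < k %/ m) V c <= balanced m k.
Proof.
rewrite -[m in m * _]card_ord -sum_nat_const; apply: alloc_le_balanced.
by rewrite sum_nat_const card_ord mulnC leq_divM.
Qed.

Lemma sum_profile_le b b' : b <= b' -> \sum_(c < b) V c <= \sum_(c < b') V c.
Proof.
by move=> /subnKC <-; rewrite big_split_ord /= leq_addr.
Qed.

(** No part of the balanced distribution exceeds the ceiling of [k / m]. *)
Lemma balanced_ceil m k : 0 < m ->
  balanced m k <= m * \sum_(c < (k + m.-1) %/ m) V c.
Proof.
move=> m0; rewrite balancedE // -[X in _ <= X * _]card_ord -sum_nat_const.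
apply: leq_sum => l _; apply: sum_profile_le.
by apply: leq_div2r; rewrite leq_add2l; case: m m0 l => // m _ l; rewrite -ltnS.
Qed.

End Profile.

(* [l = 0] gives the floor of [k / m.+1] and [l = m] its ceiling. *)
Lemma balanced_remove V m k l : (forall c c', c <= c' -> V c' <= V c) -> l <= m ->
  balanced V m.+1 k <= \sum_(c < (k + l) %/ m.+1) V c
                       + balanced V m (k - (k + l) %/ m.+1).
Proof.
move=> V_noninc; rewrite -ltnS => lm; rewrite balancedE //.
rewrite (bigD1_ord (Ordinal lm)) //= leq_add2l.
apply: (alloc_le_balanced V_noninc).
(* For [V] constantly one, [balancedE] says that the parts have [k] copies in total. The parts other
   than [l] thus form a distribution of what remains. *)
have : \sum_(i < m.+1) (k + i) %/ m.+1 = k.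
  have := balancedE (fun=> 1) k (ltn0Sn m).
  rewrite /balanced sum_nat_const card_ord muln1 => {2}->; apply: eq_bigr => i _.
  by rewrite sum_nat_const card_ord muln1.
by rewrite (bigD1_ord (Ordinal lm)) //= => {2}<-; rewrite addKn.
Qed.
(** * Invariants of the bundles on offer *)

Section Agent.

Variables (t : nat) (V : nat -> nat -> nat).
Hypothesis V_noninc : forall j c c', c <= c' -> V j c' <= V j c.

Definition bundle_value (b : nat -> nat) : nat :=
  \sum_(j < t) \sum_(c < b j) V j c.

Definition proportional (m : nat) (k : nat -> nat) : nat :=
  \sum_(j < t) balanced (V j) m (k j).

(** This expresses that the maximin share for [m] agents is at least [beta]. Copies may stay
    unassigned, which is harmless as values are nonnegative. *)
Definition feasible (beta m : nat) (k : nat -> nat) : Prop :=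
  exists a : 'I_m -> nat -> nat,
    (forall j, j < t -> \sum_l a l j <= k j) /\
    (forall l, beta <= bundle_value (a l)).

(* For [p < t] the candidate is a single copy of type [p]; then come the
   bundles with [ceil (k j / m)] copies of the first [p - t] types and
   [floor (k j / m)] copies of the others. *)
Definition quota (p m : nat) (k : nat -> nat) (j : nat) : nat :=
  if p < t then j == p : nat
  else (k j + (if j < p - t then m.-1 else 0)) %/ m.

(** The minimum makes the single-copy candidate empty once its type has run out. *)
Definition bag (p m : nat) (k : nat -> nat) (j : nat) : nat :=
  minn (k j) (quota p m k j).

(** While single goods are offered, feasibility itself is maintained. Afterwards only its
    consequence [m * beta <= proportional m k] survives the removals, together with the smallness of
    single goods and the rejection of the preceding bundle. *)
Definition pointer_inv (beta m : nat) (k : nat -> nat) (p : nat) : Prop :=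
  if p < t then
    feasible beta m k /\
    (forall j, j < p -> 0 < k j -> 2 * m * V j 0 < proportional m k)
  else
    [/\ m * beta <= proportional m k,
        forall j, j < t -> 0 < k j -> 2 * m * V j 0 < proportional m k &
        t < p -> 2 * m * bundle_value (bag p.-1 m k) < proportional m k].

Lemma bundle_value_le b b' : (forall j, j < t -> b j <= b' j) ->
  bundle_value b <= bundle_value b'.
Proof.
by move=> h; apply: leq_sum => j _; apply: sum_profile_le; apply: h.
Qed.

(** Types are separable: summing over the parts leaves one distribution per type, worth at most the
    balanced one. *)
Lemma feasible_proportional beta m k :
  feasible beta m k -> m * beta <= proportional m k.
Proof.
case=> a [ha hb]; rewrite -[m in m * _]card_ord -sum_nat_const.
apply: (@leq_trans (\sum_(l < m) bundle_value (a l))); first exact: leq_sum.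
rewrite exchange_big /=; apply: leq_sum => j _.
by apply: alloc_le_balanced; [apply: V_noninc | apply: ha].
Qed.

(* Drop a part that contains a copy of type [p], if there is one. *)
Lemma feasible_remove beta m m' k p : p < t -> feasible beta m.+1 k ->
  feasible beta m (fun j => k j - bag p m' k j).
Proof.
move=> pt [a [ha hb]].
have [l hl] : exists l, (0 < a l p) || [forall l', a l' p == 0].
  case: (boolP [forall l', a l' p == 0]) => h; first by exists ord0; rewrite orbT.
  by move/forallPn: h => [l hl]; exists l; rewrite lt0n hl.
exists (fun x => a (lift l x)); split=> // j jt.
rewrite /bag /quota pt; have := ha j jt; rewrite (bigD1_ord l) //=.
have [->|jp] := eqVneq j p; last by rewrite minn0 subn0; lia.
case/orP: hl => [hl|/forallP hl] h; first by lia.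
by rewrite big1 // => x _; apply/eqP.
Qed.

Lemma bag_phase2 p m k j : 0 < m -> t <= p ->
  bag p m k j = (k j + (if j < p - t then m.-1 else 0)) %/ m.
Proof.
move=> m0 tp; rewrite /bag /quota ltnNge tp /=; apply/minn_idPr.
rewrite -ltnS ltn_divLR //; case: ifP => _; nia.
Qed.

Lemma bag_last m k : 0 < m ->
  proportional m k <= m * bundle_value (bag (t + t) m k).
Proof.
move=> m0; rewrite /bundle_value big_distrr /=; apply: leq_sum => j _.
by rewrite bag_phase2 ?leq_addr // addnK ltn_ord; apply: balanced_ceil.
Qed.

Lemma bag_first m k : 0 < m ->
  m * bundle_value (bag t m k) <= proportional m k.
Proof.
move=> m0; rewrite /bundle_value big_distrr /=; apply: leq_sum => j _.
rewrite bag_phase2 // subnn ltn0 addn0.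
exact/balanced_floor/V_noninc.
Qed.

(** Only type [p - t] changes, from the floor to the ceiling. This adds at most one copy, and none
    if the type has run out. *)
Lemma bag_next p m k : 0 < m -> t <= p -> p < t + t ->
  bundle_value (bag p.+1 m k) <=
  bundle_value (bag p m k) + (if 0 < k (p - t) then V (p - t) 0 else 0).
Proof.
move=> m0 tp pt; have lt_t : p - t < t by lia.
rewrite /bundle_value (bigD1 (Ordinal lt_t)) //= [X in _ <= X + _](bigD1 (Ordinal lt_t)) //=.
rewrite addnAC leq_add //; last first.
  apply: leq_sum => j; rewrite -(inj_eq val_inj) /= => jp.
  by rewrite !bag_phase2 ?(leqW tp) // subSn // (ltnS j) (leq_eqVlt j) (negPf jp).
rewrite !bag_phase2 ?(leqW tp) // subSn // leqnn ltnn addn0.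
have [->|k0] := posnP (k (p - t)).
  by rewrite add0n divn_small ?big_ord0 // prednK.
have h : (k (p - t) + m.-1) %/ m <= (k (p - t) %/ m).+1.
  apply: (@leq_trans ((k (p - t) + m) %/ m)).
    by apply: leq_div2r; rewrite leq_add2l leq_pred.
  by rewrite divnDr // divnn m0 addn1.
apply: leq_trans (sum_profile_le _ h) _.
by rewrite big_ord_recr /= leq_add2l V_noninc.
Qed.

(** In each type the bag is as large as the first or the last part of the balanced distribution, so
    [balanced_remove] applies with [l] equal to 0 or [m]. *)
Lemma proportional_remove p m k : t <= p ->
  proportional m.+1 k <=
  bundle_value (bag p m.+1 k) + proportional m (fun j => k j - bag p m.+1 k j).
Proof.
move=> tp; rewrite -big_split /=; apply: leq_sum => j _.
rewrite bag_phase2 //; apply: balanced_remove; first exact: V_noninc.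
by case: ifP.
Qed.

Lemma pointer_inv0 beta m k : 0 < t -> feasible beta m k ->
  pointer_inv beta m k 0.
Proof. by move=> t0 h; rewrite /pointer_inv t0. Qed.

Lemma pointer_inv_proportional beta m k p :
  pointer_inv beta m k p -> m * beta <= proportional m k.
Proof.
rewrite /pointer_inv; case: ifP => _; last by case.
by case=> /feasible_proportional.
Qed.

Lemma pointer_inv_eq beta m k k' p : (forall j, j < t -> k j = k' j) ->
  pointer_inv beta m k p -> pointer_inv beta m k' p.
Proof.
move=> ek; have eP : proportional m k = proportional m k'.
  by apply: eq_bigr => j _; rewrite ek.
have eB q : bundle_value (bag q m k) = bundle_value (bag q m k').
  by apply: eq_bigr => j _; rewrite /bag /quota ek.
rewrite /pointer_inv -eP -eB; case: ifP => pt.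
  case=> -[a [ha hb]] hs; split; last first.
    by move=> j jp; rewrite -ek; [apply: hs | apply: ltn_trans pt].
  by exists a; split=> // j jt; rewrite -ek // ha.
by case=> h1 h2 h3; split=> // j jt; rewrite -ek //; apply: h2.
Qed.

Lemma pointer_inv_success beta m k p : 0 < m -> pointer_inv beta m k p ->
  proportional m k <= 2 * m * bundle_value (bag p m k) ->
  beta <= 2 * bundle_value (bag p m k).
Proof.
move=> m0 /pointer_inv_proportional h1 h2; rewrite -(leq_pmul2l m0).
by rewrite (leq_trans h1) // mulnCA mulnA.
Qed.

Lemma bundle_value_unit p m k : p < t -> 0 < k p ->
  bundle_value (bag p m k) = V p 0.
Proof.
move=> pt kp; rewrite /bundle_value (bigD1 (Ordinal pt)) //= [X in _ + X]big1 => [|j].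
  by rewrite /bag /quota pt eqxx (minn_idPr kp) big_ord1 addn0.
rewrite -(inj_eq val_inj) /= => /negPf jp.
by rewrite /bag /quota pt jp minn0 big_ord0.
Qed.

(** The effect of a rejection. The pointer stays in range because the bundle of all ceilings is
    worth at least [proportional m k / m] and cannot be rejected. *)
Lemma pointer_inv_next beta m k p : 0 < m -> pointer_inv beta m k p ->
  2 * m * bundle_value (bag p m k) < proportional m k ->
  p < t + t /\ pointer_inv beta m k p.+1.
Proof.
move=> m0 hp lt_U; have hU := pointer_inv_proportional hp.
have step : p < t -> forall j, j < p.+1 -> 0 < k j -> 2 * m * V j 0 < proportional m k.
  move=> pt j; rewrite ltnS leq_eqVlt => /predU1P[-> kj|jp kj].
    by move: lt_U; rewrite bundle_value_unit.
  by move: hp; rewrite /pointer_inv pt => -[_ h]; apply: h.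
move: hp; rewrite /pointer_inv; have [pt|tp] := ltnP p t.
  move=> [hf hs]; split; first by rewrite (leq_trans pt) ?leq_addr.
  case: ltnP => pt'; first by split=> //; apply: step.
  (* The phase changes here: feasibility is given up for the inequality [hU]. *)
  have e : p.+1 = t by apply/eqP; rewrite eqn_leq pt pt'.
  by split; [exact: hU | rewrite -{1}e; apply: step | rewrite e ltnn].
move=> [_ hs _]; rewrite (ltnNge p.+1) (leqW tp) /=; split; last by split.
rewrite ltnNge; apply/negP => hpt.
have : bundle_value (bag (t + t) m k) <= bundle_value (bag p m k).
  apply: bundle_value_le => j jt; rewrite !bag_phase2 ?leq_addr // addnK jt.
  by rewrite ifT // (leq_trans jt) // leq_subRL // addnC.
have := bag_last k m0; nia.
Qed.

(** The effect on an agent who stays when the bag is taken by somebody else. The pointer returns to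
    the start of its phase because earlier rejections refer to the old threshold. *)
Lemma pointer_inv_remove beta m k p : 0 < t -> 0 < m ->
    pointer_inv beta m.+1 k p ->
  pointer_inv beta m (fun j => k j - bag p m.+1 k j) (if p < t then 0 else t).
Proof.
move=> t0 m0; rewrite {1}/pointer_inv; case: ifP => pt.
  by move=> [hf _]; apply: pointer_inv0 => //; apply: feasible_remove.
move: pt => /negbT; rewrite -leqNgt => tp [hU hs hp].
(* The floor bundle is cheap anyway. A later bag consists of a rejected bundle and at most one small
   good, each worth less than half of [proportional m.+1 k / m.+1]. *)
have hb : m.+1 * bundle_value (bag p m.+1 k) <= proportional m.+1 k.
  move: tp; rewrite leq_eqVlt => /predU1P[<-|tp]; first exact: bag_first.
  case: p tp hp => // p; rewrite ltnS => tp /(_ tp) /= hp.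
  (* From [t + t] on every type is at its ceiling, so advancing the pointer leaves the bundle
     unchanged. *)
  have [pt|pt] := ltnP p (t + t); last first.
    apply: (@leq_trans (m.+1 * bundle_value (bag p m.+1 k))); last nia.
    rewrite leq_mul2l bundle_value_le ?orbT // => j jt.
    rewrite !bag_phase2 ?(leqW tp) //.
    by rewrite !ifT //; lia.
  have := bag_next k (ltn0Sn m) tp pt; case: ifP => [kp|_]; last nia.
  have lt_t : p - t < t by lia.
  have := hs _ lt_t kp; nia.
have hr := proportional_remove m k tp.
(* The proportional share per agent does not decrease; multiplying [hr] by [m.+1] and using [hb]
   shows it. Both remaining claims follow from this. *)
have hm : m * proportional m.+1 k <=
    m.+1 * proportional m (fun j => k j - bag p m.+1 k j) by nia.
rewrite /pointer_inv ltnn; split=> //.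
  rewrite -(leq_pmul2l (ltn0Sn m)) mulnCA (leq_trans _ hm) // leq_mul2l hU orbT //.
move=> j jt kj; rewrite -(ltn_pmul2l (ltn0Sn m)) (leq_trans _ hm) //.
have := hs j jt (leq_trans kj (leq_subr _ _)).
by rewrite -(ltn_pmul2l m0) => h; apply: leq_trans h; rewrite ltnS; nia.
Qed.

End Agent.

(** * The program *)

Notation "a +' b" := (Op Defs.Add a b) (at level 50, left associativity).
Notation "a -' b" := (Op Defs.Sub a b) (at level 50, left associativity).
Notation "a *' b" := (Op Defs.Mul a b) (at level 40, left associativity).
Notation "a /' b" := (Op Defs.Div a b) (at level 40, left associativity).

(* Memory layout: the arrays 0-3 are the input and 4 is the output; 5 holds
   the remaining copies of each type, 6 marks the agents that have left and 15
   is the candidate bundle. The scalars are 7: number of remaining agents,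
   8: pointer, 9: number of goods, 10: common denominator, 11-13: loop counters
   over types, agents and copies, 14: index of the first good of the current
   type, 16 and 17: the two sides of the comparison, 18: the agent that takes
   the bundle, plus one. *)
Notation vn := (Get 0 (Const 0)).
Notation vt := (Get 0 (Const 1)).
Notation vm := (var 7).
Notation vp := (var 8).
Notation vK := (var 9).
Notation vD := (var 10).
Notation vj := (var 11).
Notation vi := (var 12).
Notation vc := (var 13).
Notation voff := (var 14).
Notation vwin := (var 18).

(** Subtraction is truncated: [x -' y] tests [y < x], and one minus both differences of [vj] and
    [vp] is the indicator of their equality. *)
Definition quota_cmd : cmd :=
  For 11 vt
    (If (vt -' vp)
       (Assign 15 vj (Const 1 -' ((vj -' vp) +' (vp -' vj))))
       (If ((vp -' vt) -' vj)
          (Assign 15 vj ((Get 5 vj +' (vm -' Const 1)) /' vm))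
          (Assign 15 vj (Get 5 vj /' vm)))).

(** The values form a matrix stored by agents, with [vK] entries per row. *)
Definition scaled_value (x : expr) : expr :=
  Get 2 (vi *' vK +' x) *' (vD /' Get 3 (vi *' vK +' x)).

(** Scalar 16 accumulates the value of the bag and scalar 17 the proportional share. Array 15 holds
    the quotas; running over the remaining copies only imposes the minimum in [bag]. *)
Definition value_cmd : cmd :=
  Seq (setvar 16 (Const 0)) (Seq (setvar 17 (Const 0)) (Seq (setvar 14 (Const 0))
  (For 11 vt
    (Seq
      (For 13 (Get 5 vj)
        (Seq (setvar 17 (var 17 +' scaled_value (voff +' vc /' vm)))
             (If (Get 15 vj -' vc)
                (setvar 16 (var 16 +' scaled_value (voff +' vc))) Skip)))
      (setvar 14 (voff +' Get 1 vj)))))).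

(** Adding one before the truncated subtraction makes the test a non-strict comparison. Of several
    accepting agents the last one is recorded. *)
Definition search_cmd : cmd :=
  Seq (setvar 18 (Const 0))
  (For 12 vn
    (If (Get 6 vi) Skip
       (Seq value_cmd
          (If (Const 2 *' vm *' var 16 +' Const 1 -' var 17)
             (setvar 18 (vi +' Const 1)) Skip)))).

(** Copies are handed out from the highest index down, so the remaining copies of a type always form
    an initial segment. *)
Definition give_cmd : cmd :=
  Seq (setvar 14 (Const 0))
  (For 11 vt
    (Seq
      (For 13 (Get 5 vj)
        (If (Get 15 vj -' vc)
           (Assign 4 (voff +' (Get 5 vj -' (vc +' Const 1))) (vwin -' Const 1))
           Skip))
      (Seq (Assign 5 vj (Get 5 vj -' Get 15 vj))
           (setvar 14 (voff +' Get 1 vj))))).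

Definition leave_cmd : cmd :=
  Seq (Assign 6 (vwin -' Const 1) (Const 1))
  (Seq (setvar 7 (vm -' Const 1))
       (If (vt -' vp) (setvar 8 (Const 0)) (setvar 8 vt))).

Definition step_cmd : cmd :=
  Seq quota_cmd
  (Seq search_cmd
       (If vwin (Seq give_cmd leave_cmd) (setvar 8 (vp +' Const 1)))).

Definition init_cmd : cmd :=
  Seq (For 11 vt (Seq (Assign 5 vj (Get 1 vj)) (setvar 9 (vK +' Get 1 vj))))
  (Seq (setvar 10 (Const 1))
  (Seq (For 12 (vn *' vK) (setvar 10 (vD *' Get 3 vi)))
       (If vK (setvar 7 vn) Skip))).

Definition splc_cmd : cmd := Seq init_cmd (While vm step_cmd).

(** * Frame conditions *)

Definition same (l : seq nat) (s s' : state) : Prop :=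
  forall y, y \notin l -> s' y =1 s y.

Lemma same_trans l s1 s2 s3 : same l s1 s2 -> same l s2 s3 -> same l s1 s3.
Proof. by move=> h1 h2 y hy a; rewrite h2 ?h1. Qed.

Lemma same_sub l l' s s' : {subset l <= l'} -> same l s s' -> same l' s s'.
Proof. by move=> hl h y hy; apply: h; apply: contra hy; apply: hl. Qed.

Lemma same_update l s s' x a v : x \in l -> same l s s' ->
  same l s (update s' x a v).
Proof.
move=> xl h y hy b; rewrite /update; case: eqP => [yx|_] /=; last exact: h.
by rewrite yx xl in hy.
Qed.

(** * Correctness of the subprograms *)

Section Memory.

Variables (N w n t K D M : nat) (cp num den : nat -> nat).

Definition offset (j : nat) : nat := \sum_(j' < j) cp j'.

Definition int_value (i x : nat) : nat :=
  num (i * K + x) * (D %/ den (i * K + x)).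

Record env (s : state) : Prop := Env {
  env_n : s 0 0 = n;
  env_t : s 0 1 = t;
  env_cp : s 1 =1 cp;
  env_num : s 2 =1 num;
  env_den : s 3 =1 den;
  env_K : s 9 0 = K;
  env_D : s 10 0 = D;
  env_k : forall j, j < t -> s 5 j <= cp j;
  env_m : s 7 0 <= n;
  env_p : s 8 0 <= t + t
}.

Hypothesis K_offset : K = offset t.
Hypothesis value_leM : forall i x, int_value i x <= M.
Hypotheses (nN : n <= N) (tN : t <= N) (KN : K <= N).
Hypothesis sums_lt : t * (K * M) < 2 ^ w.
Hypothesis counters_lt : n + (t + t) + K + 2 < 2 ^ w.

Lemma w_gt0 : 0 < w.
Proof. by case: w counters_lt => //; rewrite expn0 !addnS. Qed.

Lemma cp_leK j : j < t -> cp j <= K.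
Proof. by move=> jt; rewrite K_offset /offset (bigD1 (Ordinal jt)) //= leq_addr. Qed.

Lemma offsetS j : offset j.+1 = offset j + cp j.
Proof. by rewrite /offset big_ord_recr. Qed.

Lemma offset_mono j j' : j <= j' -> offset j <= offset j'.
Proof. by move=> /subnKC <-; rewrite /offset big_split_ord leq_addr. Qed.

Lemma offset_leK j : j <= t -> offset j <= K.
Proof. by rewrite K_offset; apply: offset_mono. Qed.

Lemma offset_inj j c j' c' : c < cp j -> c' < cp j' ->
  offset j + c = offset j' + c' -> j = j' /\ c = c'.
Proof.
wlog le_j : j c j' c' / j <= j'.
  move=> hw hc hc' e; case/orP: (leq_total j j') => h; first exact: hw.
  by have [-> ->] := hw _ _ _ _ h hc' hc (esym e).
move=> hc hc' e; case: (ltngtP j j') le_j => // [lt_j|ej] _.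
  by have := offset_mono lt_j; rewrite offsetS; lia.
by split=> //; move: e; rewrite ej => /addnI.
Qed.

Lemma env_same l s s' : all (mem [:: 4; 6; 11; 12; 13; 14; 15; 16; 17; 18]) l ->
  same l s s' -> env s -> env s'.
Proof.
move=> /allP hl h [e1 e2 e3 e4 e5 e6 e7 e8 e9 e10].
have {}h y : y \notin [:: 4; 6; 11; 12; 13; 14; 15; 16; 17; 18] -> s' y =1 s y.
  by move=> hy; apply: h; apply: contra hy; apply: hl.
split; try by [rewrite h|move=> x; rewrite h].
by move=> j jt; rewrite h // e8.
Qed.

Lemma ok_quota s (Q : state -> Prop) : env s ->
    (forall s', same [:: 11; 15] s s' ->
      (forall j, j < t -> s' 15 j = quota t (s 8 0) (s 7 0) (s 5) j) -> Q s') ->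
  ok N w quota_cmd s Q.
Proof.
move=> es hQ.
pose Inv i (s' : state) := same [:: 11; 15] s s' /\
  (forall j, j < i -> s' 15 j = quota t (s 8 0) (s 7 0) (s 5) j).
apply: (@ok_for _ _ Inv _ _ _ t) => //; first exact: w_gt0.
- by move: counters_lt; lia.
- by split=> //; apply: same_update.
- by move=> i s' _ _ [h _] /=; rewrite h // env_t.
- move=> i s' it si [h hi].
  have kK : s 5 i <= K by rewrite (leq_trans (env_k es it)) ?cp_leK.
  have mn := env_m es.
  have sE := (si, h 0 isT, h 5 isT, h 7 isT, h 8 isT, env_t es).
  have done_ v : v = quota t (s 8 0) (s 7 0) (s 5) i ->
     same [:: 11; 15] s (update (update s' 15 i v) 11 0 i.+1) /\
    forall j, j < i.+1 -> update (update s' 15 i v) 11 0 i.+1 15 j =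
       quota t (s 8 0) (s 7 0) (s 5) j.
    move=> ->; split; first by apply: same_update => //; apply: same_update.
    move=> j; rewrite ltnS leq_eqVlt /update /=.
    by case: eqVneq => [-> //|_] /= ji; apply: hi.
  have div_lt a b : a <= n + K -> a %/ b < 2 ^ w.
    move=> ab; rewrite (leq_ltn_trans (leq_div _ _)) // (leq_ltn_trans ab) //.
    by move: counters_lt; lia.
  apply: (@ok_if _ _ w_gt0); rewrite /= ?sE => ht.
    apply: (@ok_assign _ _ w_gt0); [rewrite /= ?sE |].
      by move: counters_lt; lia.
    rewrite /= ?sE; split=> //; apply: done_.
    by rewrite /quota; case: ltnP => ?; [case: eqP|]; lia.
  have tp : t <= s 8 0 by lia.
  have qE : quota t (s 8 0) (s 7 0) (s 5) i =
     (s 5 i + (if i < s 8 0 - t then (s 7 0).-1 else 0)) %/ s 7 0.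
    by rewrite /quota ltnNge tp.
  apply: (@ok_if _ _ w_gt0); rewrite /= ?sE => hi'.
    apply: (@ok_assign _ _ w_gt0); [rewrite /= ?sE |].
      by apply: div_lt; lia.
    rewrite /= ?sE; split=> //; apply: done_.
    by rewrite qE subn1 ifT //; lia.
  apply: (@ok_assign _ _ w_gt0); [rewrite /= ?sE |].
    by apply: div_lt; lia.
  rewrite /= ?sE; split=> //; apply: done_.
  by rewrite qE ifF ?addn0 //; lia.
- by move=> s' _ [h hi]; apply: hQ.
Qed.


Lemma sum_le_mul (F : nat -> nat) B x : (forall c, F c <= B) ->
  \sum_(c < x) F c <= x * B.
Proof.
move=> hF; rewrite -[x in x * B]card_ord -sum_nat_const.
exact: leq_sum.
Qed.

(** Rules out overflow of the accumulators: [j] complete types and a part of the next one contribute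
    at most [t * (K * M)]. *)
Lemma partial_sum_lt (F : nat -> nat -> nat) (k : nat -> nat) j x y :
    (forall j c, F j c <= M) -> (forall j, j < t -> k j <= K) ->
    j < t -> x <= K -> y <= \sum_(c < x) F j c ->
  \sum_(j' < j) \sum_(c < k j') F j' c + y < 2 ^ w.
Proof.
move=> hF hk jt xK hy; apply: leq_ltn_trans sums_lt.
apply: (@leq_trans (j.+1 * (K * M))); last by rewrite leq_mul2r jt orbT.
rewrite mulSnr leq_add //.
  rewrite -[j in j * _]card_ord -sum_nat_const; apply: leq_sum => j' _.
  rewrite (leq_trans (sum_le_mul _ (hF j'))) // leq_mul2r hk ?orbT //.
  exact: ltn_trans jt.
rewrite (leq_trans hy) // (leq_trans (sum_le_mul _ (hF j))) // leq_mul2r xK.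
by rewrite orbT.
Qed.

Lemma ok_value s i (Q : state -> Prop) : env s -> s 12 0 = i ->
    (forall s', same [:: 11; 13; 14; 16; 17] s s' ->
      s' 16 0 = \sum_(j < t) \sum_(c < minn (s 5 j) (s 15 j))
                   int_value i (offset j + c) ->
      s' 17 0 = \sum_(j < t) \sum_(c < s 5 j)
                   int_value i (offset j + c %/ s 7 0) -> Q s') ->
  ok N w value_cmd s Q.
Proof.
move=> es si hQ; have pow_gt0 : 0 < 2 ^ w by rewrite expn_gt0.
have kK j : j < t -> s 5 j <= K.
  by move=> jt; rewrite (leq_trans (env_k es jt)) ?cp_leK.
pose F16 j c := int_value i (offset j + c).
pose F17 j c := int_value i (offset j + c %/ s 7 0).
pose Inv j (s' : state) :=
  [/\ same [:: 11; 13; 14; 16; 17] s s', s' 14 0 = offset j,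
      s' 16 0 = \sum_(j' < j) \sum_(c < minn (s 5 j') (s 15 j')) F16 j' c &
      s' 17 0 = \sum_(j' < j) \sum_(c < s 5 j') F17 j' c].
rewrite /value_cmd.
apply: ok_seq; apply: (@ok_assign _ _ w_gt0) => //=.
apply: ok_seq; apply: (@ok_assign _ _ w_gt0) => //=.
apply: ok_seq; apply: (@ok_assign _ _ w_gt0) => //=.
apply: (@ok_for _ _ Inv _ _ _ t) => //; first exact: w_gt0.
- by move: counters_lt; lia.
- split; rewrite /update /= /offset ?big_ord0 //.
  by do 4 apply: same_update => //.
- by move=> j s' _ _ [h _ _ _] /=; rewrite h // env_t.
- move=> j s1 jt sj [h1 h14 h16 h17].
  apply: ok_seq.
  pose Inv' c (s' : state) :=
    [/\ same [:: 11; 13; 14; 16; 17] s s', s' 14 0 = offset j, s' 11 0 = j,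
      s' 16 0 = s1 16 0 + \sum_(c' < minn c (s 15 j)) F16 j c' &
      s' 17 0 = s1 17 0 + \sum_(c' < c) F17 j c'].
  apply: (@ok_for _ _ Inv' _ _ _ (s 5 j)).
  + exact: w_gt0.
  + exact: leq_trans (kK _ jt) KN.
  + by move: (kK _ jt) counters_lt; lia.
  + split; rewrite /update ?min0n ?big_ord0 ?addn0 //=.
    exact: same_update.
  + by move=> c s' _ _ [h _ sj' _ _] /=; rewrite sj' h.
  + move=> c s2 ck sc [h h14' sj' h16' h17'].
    have xE := (sc, sj', h 0 isT, h 1 isT, h 2 isT, h 3 isT, h 5 isT, h 7 isT,
      h 9 isT, h 10 isT, h 12 isT, h 15 isT, env_K es, env_D es, env_num es,
      env_den es, si, h14').
    apply: ok_seq; apply: (@ok_assign _ _ w_gt0); rewrite /= ?xE.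
      rewrite h17' h17 -addnA; apply: (@partial_sum_lt F17 _ _ c.+1) => //.
      - by move=> *; apply: value_leM.
      - exact: leq_trans (kK _ jt).
      - by rewrite big_ord_recr.
    have {}h17' : s2 17 0 + F17 j c = s1 17 0 + \sum_(c' < c.+1) F17 j c'.
      by rewrite h17' big_ord_recr /= addnA.
    apply: (@ok_if _ _ w_gt0); rewrite /= /update /= ?xE => hb.
      have e1 : minn c (s 15 j) = c by lia.
      have e2 : minn c.+1 (s 15 j) = c.+1 by lia.
      apply: (@ok_assign _ _ w_gt0); rewrite /= /update /= ?xE.
        rewrite h16' e1 h16 -addnA.
        apply: (@partial_sum_lt F16 (fun j => minn (s 5 j) (s 15 j)) _ c.+1) => //.
        - by move=> *; apply: value_leM.
        - by move=> j' jt'; rewrite (leq_trans (geq_minl _ _)) ?kK.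
        - exact: leq_trans (kK _ jt).
        - by rewrite big_ord_recr.
      split=> //; split; rewrite /update /= //.
        by do 3 apply: same_update => //.
      by rewrite h16' e1 e2 big_ord_recr [RHS]addnA.
    apply: ok_skip; split=> //; split; rewrite /update /= //.
      by do 2 apply: same_update => //.
    by rewrite h16'; congr (_ + _); rewrite (_ : minn c.+1 _ = minn c (s 15 j)) //; lia.
  + move=> s2 _ [h h14' sj' h16' h17'].
    have xE := (sj', h 1 isT, env_cp es, h14').
    apply: (@ok_assign _ _ w_gt0); rewrite /= ?xE.
      have := offset_leK jt; rewrite offsetS.
      by move: counters_lt; lia.
    split=> //; split; rewrite /update /= ?offsetS //.
    * by do 2 apply: same_update => //.
    * by rewrite big_ord_recr h16' h16.
    * by rewrite big_ord_recr h17' h17.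
- by move=> s' _ [h _ h16 h17]; apply: hQ.
Qed.

(* Zero beyond the last copy, so as to be nonincreasing everywhere. *)
Definition copy_value (i j c : nat) : nat :=
  if c < cp j then int_value i (offset j + c) else 0.

Definition accepts (s : state) (i : nat) : bool :=
  (s 6 i == 0) &&
  (proportional t (copy_value i) (s 7 0) (s 5) <=
   2 * s 7 0 * bundle_value t (copy_value i) (bag t (s 8 0) (s 7 0) (s 5))).

Lemma ok_search s (Q : state -> Prop) : env s ->
    (forall j, j < t -> s 15 j = quota t (s 8 0) (s 7 0) (s 5) j) ->
    (forall s', same [:: 11; 12; 13; 14; 16; 17; 18] s s' ->
      (s' 18 0 = 0 -> forall i, i < n -> ~~ accepts s i) ->
      (forall v, s' 18 0 = v.+1 -> v < n /\ accepts s v) -> Q s') ->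
  ok N w search_cmd s Q.
Proof.
move=> es hq hQ.
pose Inv i (s' : state) := [/\ same [:: 11; 12; 13; 14; 16; 17; 18] s s',
  s' 18 0 = 0 -> forall i', i' < i -> ~~ accepts s i' &
  forall v, s' 18 0 = v.+1 -> v < i /\ accepts s v].
apply: ok_seq; apply: (@ok_assign _ _ w_gt0); rewrite /= ?expn_gt0 //.
apply: (@ok_for _ _ Inv _ _ _ n) => //; first exact: w_gt0.
- by move: counters_lt; lia.
- by split=> //; do 2 apply: same_update => //.
- by move=> i s' _ _ [h _ _] /=; rewrite h // env_n.
- move=> i s1 lt_in si [h h0 hS].
  have ltS a : a < i.+1 -> a != i -> a < i by lia.
  have skip s2 : same [:: 11; 12; 13; 14; 16; 17; 18] s s2 -> s2 12 0 = i ->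
      s2 18 0 = s1 18 0 -> ~~ accepts s i ->
      s2 12 0 = i /\ Inv i.+1 (update s2 12 0 i.+1).
    move=> h2 e12 e18 hi; split=> //; split; rewrite /update /= ?e18.
    + exact: same_update.
    + by move=> w0 i' i'i; case: (eqVneq i' i) => [->//|ne]; apply: h0 => //; apply: ltS.
    + by move=> v /hS [vi av]; split=> //; apply: ltnW.
  apply: (@ok_if _ _ w_gt0); rewrite /= si h // => s6i.
    by apply: ok_skip; apply: skip; rewrite ?/accepts ?(negPf s6i).
  have es1 := @env_same [:: 11; 12; 13; 14; 16; 17; 18] s s1 isT h es.
  apply: ok_seq; apply: (ok_value es1 si) => s2 h2 h16 h17.
  have hs2 : same [:: 11; 12; 13; 14; 16; 17; 18] s s2.
    apply: same_trans h _; apply: same_sub h2.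
    by apply/allP.
  (* Only copies below [cp j] are summed, where [copy_value] agrees with [int_value]. *)
  have acc : accepts s i = (s2 17 0 <= 2 * s 7 0 * s2 16 0).
    rewrite /accepts s6i eqxx h16 h17 /=; congr (_ <= _ * _).
      apply: eq_bigr => j _; rewrite h // /balanced; apply: eq_bigr => c _.
      have := env_k es (ltn_ord j); have := leq_div c (s 7 0).
      rewrite /copy_value h //; case: ltnP => //; have := ltn_ord c; lia.
    apply: eq_bigr => j _; rewrite !h // hq // -/(bag _ _ _ _ _).
    apply: eq_bigr => c _; rewrite /copy_value ifT //.
    have := env_k es (ltn_ord j); have := ltn_ord c.
    rewrite /bag /=; lia.
  have e12 : s2 12 0 = i by rewrite h2.
  have e18 : s2 18 0 = s1 18 0 by rewrite h2.
  apply: (@ok_if _ _ w_gt0); rewrite /= (hs2 7) //.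
    rewrite addn1 -lt0n subn_gt0 ltnS -acc => acci.
    apply: (@ok_assign _ _ w_gt0); rewrite /= ?e12.
      by move: counters_lt; lia.
    split=> //; split; rewrite /update /= ?addn1 //.
    + by do 2 apply: same_update => //.
    + by move=> v [<-].
  rewrite addn1 => /eqP; rewrite subn_eq0 ltnNge -acc => acci.
  by apply: ok_skip; apply: skip.
- by move=> s' _ [h h0 hS]; apply: hQ.
Qed.

Lemma ok_give s v (Q : state -> Prop) : env s -> s 18 0 = v.+1 -> v < n ->
    (forall s', same [:: 4; 5; 11; 13; 14] s s' ->
      (forall j, j < t -> s' 5 j = s 5 j - s 15 j) ->
      (forall j c, j < t -> c < cp j -> s' 4 (offset j + c) =
         if s 5 j - s 15 j <= c < s 5 j then v else s 4 (offset j + c)) ->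
      (forall x, s' 4 x = v \/ s' 4 x = s 4 x) -> Q s') ->
  ok N w give_cmd s Q.
Proof.
move=> es sv vn hQ.
have kK j : j < t -> s 5 j <= K.
  by move=> jt; rewrite (leq_trans (env_k es jt)) ?cp_leK.
pose Inv j (s' : state) :=
  [/\ same [:: 4; 5; 11; 13; 14] s s', s' 14 0 = offset j,
      forall i, i < t -> s' 5 i = if i < j then s 5 i - s 15 i else s 5 i,
      forall i c, i < t -> c < cp i -> s' 4 (offset i + c) =
         if (i < j) && (s 5 i - s 15 i <= c < s 5 i) then v
         else s 4 (offset i + c) &
      forall x, s' 4 x = v \/ s' 4 x = s 4 x].
apply: ok_seq; apply: (@ok_assign _ _ w_gt0); rewrite /= ?expn_gt0 //.
apply: (@ok_for _ _ Inv _ _ _ t) => //; first exact: w_gt0.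
- by move: counters_lt; lia.
- split; rewrite /update /= /offset ?big_ord0 //; last by right.
  by do 2 apply: same_update => //.
- by move=> j s' _ _ [h _ _ _ _] /=; rewrite h // env_t.
- move=> j s1 jt sj [h1 h14 h5 h4 hx].
  have s1j : s1 5 j = s 5 j by rewrite h5 // ltnn.
  pose Inv' d (s' : state) :=
    [/\ [/\ same [:: 4; 5; 11; 13; 14] s s', s' 14 0 = offset j, s' 11 0 = j &
         s' 5 =1 s1 5],
      forall i c, i < t -> c < cp i -> s' 4 (offset i + c) =
         if (i == j) && (s 5 j - minn d (s 15 j) <= c < s 5 j) then v
         else s1 4 (offset i + c) &
      forall x, s' 4 x = v \/ s' 4 x = s 4 x].
  apply: ok_seq; apply: (@ok_for _ _ Inv' _ _ _ (s 5 j)).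
  + exact: w_gt0.
  + exact: leq_trans (kK _ jt) KN.
  + by move: (kK _ jt) counters_lt; lia.
  + split; rewrite /update //=; first by split=> //; apply: same_update.
    move=> i c it ci; rewrite min0n subn0; case: eqP => //= _.
    by case: ltnP => // h; rewrite ltnNge h.
  + by move=> c s' _ _ [[h _ sj' h5'] _ _] /=; rewrite sj' h5'.
  + move=> d s2 dk sd [[h h14' sj' h5'] h4' hx'].
    apply: (@ok_if _ _ w_gt0); rewrite /= /update /= ?sd ?sj' h // => hb.
      apply: (@ok_assign _ _ w_gt0); rewrite /= /update /= ?sd ?sj' ?h14' ?h5' ?s1j h // sv.
        by rewrite subn1 /=; move: counters_lt; lia.
      split=> //; split; first by split=> //; do 2 apply: same_update => //.
        move=> i c it ci /=; rewrite subn1 h4' //=.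
        (* Pass [d] writes the cell of this copy, which extends the assigned interval downwards by
           one. By [offset_inj] no other copy shares the cell. *)
        have kc : s 5 j - (d + 1) < cp j by have := env_k es jt; lia.
        case: eqP => [e|ne].
          have [-> ->] := offset_inj ci kc e.
          by rewrite eqxx ifT //; lia.
        case: (eqVneq i j) => //= eij.
        have nc : c <> s 5 j - (d + 1) by move=> ec; apply: ne; rewrite eij ec.
        by congr (if _ then _ else _); lia.
      by move=> x /=; case: eqP => [_|_]; [left; rewrite subn1 | apply: hx'].
    apply: ok_skip; split=> //; split=> //; first by split=> //; apply: same_update.
    move=> i c it ci; rewrite /update /= h4' //.
    by rewrite (_ : minn d.+1 _ = minn d (s 15 j)) //; lia.
  + move=> s2 _ [[h h14' sj' h5'] h4' hx'].
    have s2j : s2 5 j = s 5 j by rewrite h5'.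
    apply: ok_seq; apply: (@ok_assign _ _ w_gt0); rewrite /= ?sj' ?s2j ?h //.
      by move: (kK _ jt) counters_lt; lia.
    apply: (@ok_assign _ _ w_gt0); rewrite /= /update /= ?sj' ?h14' ?h // env_cp //.
      by have := offset_leK jt; rewrite offsetS; move: counters_lt; lia.
    split=> //; split; rewrite /update /= ?offsetS //.
    * by do 3 apply: same_update => //.
    * move=> i it; case: eqP => [->|/eqP ne]; first by rewrite ltnS leqnn.
      by rewrite h5' h5 // (ltnS i) (leq_eqVlt i) (negPf ne).
    * move=> i c it ci; rewrite h4' // h4 // (ltnS i) (leq_eqVlt i).
      case: eqP => [->|ne] //=; rewrite ltnn /=; congr (if _ then _ else _).
      lia.
- by move=> s' _ [h h14 h5 h4 hx]; apply: hQ => // [j jt|j c jt cj];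
    rewrite ?h5 ?h4 // jt.
Qed.

(** * One round of the main loop and the loop invariant *)

Definition failed (s s' : state) : Prop :=
  [/\ same [:: 8; 11; 12; 13; 14; 15; 16; 17; 18] s s', s' 8 0 = (s 8 0).+1 &
      forall i, i < n -> ~~ accepts s i].

Definition served (s s' : state) (v : nat) : Prop :=
  [/\ v < n /\ accepts s v,
      same [:: 4; 5; 6; 7; 8; 11; 12; 13; 14; 15; 16; 17; 18] s s',
      [/\ s' 7 0 = (s 7 0).-1, s' 8 0 = (if s 8 0 < t then 0 else t) &
          forall i, s' 6 i = if i == v then 1 else s 6 i],
      forall j, j < t -> s' 5 j = s 5 j - bag t (s 8 0) (s 7 0) (s 5) j &
      (forall j c, j < t -> c < cp j -> s' 4 (offset j + c) =
         if s' 5 j <= c < s 5 j then v else s 4 (offset j + c)) /\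
      (forall x, s' 4 x = v \/ s' 4 x = s 4 x)].

Lemma ok_step s (Q : state -> Prop) : env s ->
    (forall s', failed s s' -> Q s') ->
    (forall s' v, served s s' v -> Q s') ->
  ok N w step_cmd s Q.
Proof.
move=> es hfail hserve.
apply: ok_seq; apply: (ok_quota es) => s1 h1 hq.
have es1 := @env_same [:: 11; 15] s s1 isT h1 es.
have ebag j : bag t (s1 8 0) (s1 7 0) (s1 5) j = bag t (s 8 0) (s 7 0) (s 5) j.
  by rewrite /bag /quota !h1.
have eacc i : accepts s1 i = accepts s i.
  rewrite /accepts !h1 //; congr (_ && (_ <= _)).
    by apply: eq_bigr => j _; rewrite h1.
  by congr (_ * _); apply: eq_bigr => j _; rewrite -ebag !h1.
apply: ok_seq; apply: (ok_search es1) => [j jt|s2 h2 h20 h2S].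
  by rewrite hq // /quota !h1.
have es2 := @env_same [:: 11; 12; 13; 14; 16; 17; 18] s1 s2 isT h2 es1.
apply: (@ok_if _ _ w_gt0) => /= win.
  case e18: (s2 18 0) win => [|v] // _.
  have [vn av] := h2S _ e18; rewrite eacc in av.
  apply: ok_seq; apply: (ok_give es2 e18 vn) => s3 h3 h5 h4 hx.
  have k5 j : j < t -> s3 5 j = s 5 j - bag t (s 8 0) (s 7 0) (s 5) j.
    move=> jt; rewrite h5 // !h2 // h1 // hq // /bag.
    by rewrite minnE subKn ?leq_subr //; lia.
  have e7 : s3 7 0 = s 7 0 by rewrite h3 // h2 // h1.
  have e8 : s3 8 0 = s 8 0 by rewrite h3 // h2 // h1.
  have e0 : s3 0 1 = t by rewrite h3 // env_t.
  have e18' : s3 18 0 = v.+1 by rewrite h3.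
  rewrite /leave_cmd.
  apply: ok_seq; apply: (@ok_assign _ _ w_gt0); rewrite /= ?e18'.
    by move: counters_lt; lia.
  apply: ok_seq; apply: (@ok_assign _ _ w_gt0); rewrite /= /update /= ?e7.
    by have := env_m es; move: counters_lt; lia.
  have fin p s4 : p = (if s 8 0 < t then 0 else t) ->
    s4 = update (update (update s3 6 v 1) 7 0 (s 7 0).-1) 8 0 p -> Q s4.
    move=> ep ->; apply: (hserve _ v); split=> //.
    + do 3 apply: same_update => //.
      apply: (same_trans (same_sub _ h1)); first by apply/allP.
      apply: (same_trans (same_sub _ h2)); first by apply/allP.
      by apply: same_sub h3; apply/allP.
    + split; rewrite /update /= ?ep // => i; case: eqP => //= _.
      by rewrite h3 // h2 // h1.
    + split=> [j c jt cj|x]; rewrite /update /=.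
        by rewrite h4 // h5 // (h2 5) // (h2 4) // (h1 5) // (h1 4).
      by case: (hx x) => ->; [left|right; rewrite h2 // h1].
  apply: (@ok_if _ _ w_gt0); rewrite /= /update /= e0 e8 => ht;
    apply: (@ok_assign _ _ w_gt0); rewrite /= /update /= ?e0 ?e8 ?expn_gt0 //.
  - by apply: (fin 0); [rewrite ifT //; lia | rewrite subn1 subn1].
  - by move: counters_lt; lia.
  - by apply: (fin t); [rewrite ifF //; lia | rewrite subn1 subn1].
have e8 : s2 8 0 = s 8 0 by rewrite h2 // h1.
apply: (@ok_assign _ _ w_gt0); rewrite /= e8 addn1.
  by have := env_p es; move: counters_lt; lia.
apply: hfail; split=> //.
  apply: same_update => //.
  apply: (same_trans (same_sub _ h1)); first by apply/allP.
  by apply: same_sub h2; apply/allP.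
by move=> i /(h20 win); rewrite eacc.
Qed.

Hypothesis copy_value_noninc : forall i, i < n ->
  forall j c c', c <= c' -> copy_value i j c' <= copy_value i j c.
Hypothesis t_gt0 : 0 < t.
Hypothesis iterations_le : n * (t + t).+1 + (t + t) <= N.

(** Array 4 is initially zero, so cells of remaining copies name agent 0 by default. The guard
    [s 5 j <= c] keeps only the copies actually handed out. *)
Definition received (s : state) (i j : nat) : nat :=
  \sum_(c < cp j) ((s 5 j <= c) && (s 4 (offset j + c) == i)).

Definition active (s : state) : nat := \sum_(i < n) (s 6 i == 0).

(** Quantifying over every [beta] feasible in the original instance replaces the maximin share by
    natural numbers. *)
Record main_inv (s : state) : Prop := MainInv {
  main_env : env s;
  main_active : s 7 0 = active s;
  main_pointer : forall i beta, i < n -> s 6 i = 0 ->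
    feasible t (copy_value i) beta n cp ->
    pointer_inv t (copy_value i) beta (s 7 0) (s 5) (s 8 0);
  main_served : forall i beta, i < n -> s 6 i != 0 ->
    feasible t (copy_value i) beta n cp ->
    beta <= 2 * bundle_value t (copy_value i) (received s i);
  main_owner : forall x, s 4 x < n
}.

Lemma feasible0 V m k : feasible t V 0 m k.
Proof. by exists (fun _ _ => 0); split=> // j _; rewrite big1. Qed.

Lemma active_gt0 s i : i < n -> s 6 i = 0 -> 0 < active s.
Proof. by move=> lt_in si; rewrite /active (bigD1 (Ordinal lt_in)) //= si. Qed.

Lemma ex_active s : 0 < active s -> exists2 i, i < n & s 6 i = 0.
Proof.
rewrite lt0n sum_nat_eq0 => /forallPn[i]; rewrite /= eqb0 negbK => /eqP si.
by exists i.
Qed.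

Lemma failed_inv s s' : main_inv s -> 0 < s 7 0 -> failed s s' ->
  s 8 0 < t + t /\ main_inv s'.
Proof.
move=> [es ha hp hs ho] m0 [h p' rej].
have next i beta : i < n -> s 6 i = 0 ->
    feasible t (copy_value i) beta n cp -> s 8 0 < t + t /\
    pointer_inv t (copy_value i) beta (s 7 0) (s 5) (s 8 0).+1.
  move=> lt_in si hf.
  apply: (pointer_inv_next (copy_value_noninc lt_in) m0 (hp _ _ lt_in si hf)).
  by have := rej _ lt_in; rewrite /accepts si eqxx /= -ltnNge.
have [i lt_in si] : exists2 i, i < n & s 6 i = 0.
  by apply: ex_active; rewrite -ha.
(* The share 0 is always feasible, so the bound on the pointer is unconditional. *)
have [pt _] := next i 0 lt_in si (feasible0 _ _ _); split=> //.
have pE (V : nat -> nat -> nat) beta p : pointer_inv t V beta (s 7 0) (s 5) p ->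
    pointer_inv t V beta (s' 7 0) (s' 5) p.
  rewrite (h 7) // => {}hp; apply: pointer_inv_eq hp => j _.
  by rewrite h.
split.
- case: es => *; split=> //; try by [rewrite h|move=> x; rewrite h].
  + by move=> j jt; rewrite h //; auto.
  + by rewrite p'.
- by rewrite h // ha; apply: eq_bigr => l _; rewrite h.
- move=> l beta ln; rewrite h // => sl hf; rewrite p'; apply: pE.
  by have [] := next l beta ln sl hf.
- move=> l beta ln; rewrite h // => sl hf.
  apply: (leq_trans (hs _ _ ln sl hf)); rewrite leq_mul2l /=.
  apply: bundle_value_le => j _; apply: leq_sum => c _.
  by rewrite (h 5) // (h 4).
- by move=> x; rewrite h.
Qed.

Lemma sum_interval a k x : \sum_(c < x) (a <= c < k) = minn x k - minn x a.
Proof.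
elim: x => [|x IH]; first by rewrite big_ord0 !min0n.
by rewrite big_ord_recr /= IH; case: (leqP a x) => ?; case: (ltnP x k) => ?; lia.
Qed.

Lemma served_inv s s' v : main_inv s -> 0 < s 7 0 -> served s s' v ->
  main_inv s'.
Proof.
move=> [es ha hp hs ho] m0 [[vn av] h [h7 h8 h6] h5 [h4 hx]].
have [sv acc] := andP av; move/eqP in sv.
have act' : active s = (active s').+1.
  rewrite /active (bigD1 (Ordinal vn)) //= sv eqxx; congr _.+1.
  rewrite [RHS](bigD1 (Ordinal vn)) //= h6 eqxx.
  by apply: eq_bigr => l; rewrite -(inj_eq val_inj) /= h6 => /negPf ->.
have le5 j : j < t -> s' 5 j <= s 5 j by move=> jt; rewrite h5 // leq_subr.
split.
- case: es => *; split=> //; try by [rewrite h|move=> x; rewrite h].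
  + by move=> j jt; apply: (leq_trans (le5 _ jt)); auto.
  + by rewrite h7; apply: leq_trans (leq_pred _) _.
  + by rewrite h8; case: ifP => // _; apply: leq_addr.
- by rewrite h7 ha act'.
- move=> i beta lt_in; rewrite h6; case: eqP => // ne si hf.
  have mE : s 7 0 = (s' 7 0).+1 by rewrite h7 prednK.
  have m'0 : 0 < s' 7 0.
    rewrite h7 ha act' /=; apply: (active_gt0 lt_in).
    by rewrite h6; case: eqP.
  have := hp _ _ lt_in si hf; rewrite h8 mE => hpi.
  have := pointer_inv_remove (copy_value_noninc lt_in) t_gt0 m'0 hpi.
  by apply: pointer_inv_eq => j jt; rewrite h5 // mE.
- move=> i beta lt_in; rewrite h6; case: (eqVneq i v) => [-> _ hf|/eqP ne si hf].
    have hpv := hp _ _ vn sv hf.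
    apply: leq_trans (pointer_inv_success (copy_value_noninc vn) m0 hpv acc) _.
    rewrite leq_mul2l /=; apply: bundle_value_le => j jt.
    have kc := env_k es jt.
    (* Agent [v] has just received the copies from [s' 5 j] up to [s 5 j], exactly as many as the
       bag contains. *)
    apply: (@leq_trans (\sum_(c < cp j) (s' 5 j <= c < s 5 j))).
      rewrite sum_interval h5 //.
      have : bag t (s 8 0) (s 7 0) (s 5) j <= s 5 j by apply: geq_minl.
      lia.
    apply: leq_sum => c _; rewrite h4 //.
    by case: ifP => [/andP[-> _]|_]; rewrite ?eqxx.
  (* An agent served earlier keeps her copies: they lie at or above [s 5 j], outside the interval
     just written. *)
  apply: (leq_trans (hs _ _ lt_in si hf)); rewrite leq_mul2l /=.
  apply: bundle_value_le => j jt; apply: leq_sum => c _.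
  rewrite h4 // ; case: (leqP (s 5 j) c) => //= kc.
  by rewrite (leq_trans (le5 _ jt) kc) andbF.
- by move=> x; case: (hx x) => ->.
Qed.

Lemma ok_main s (Q : state -> Prop) : main_inv s ->
    (forall s', (forall x, s' 4 x < n) ->
      (forall i beta, i < n -> feasible t (copy_value i) beta n cp ->
         beta <= 2 * bundle_value t (copy_value i)
           (fun j => \sum_(c < cp j) (s' 4 (offset j + c) == i))) -> Q s') ->
  ok N w (While vm step_cmd) s Q.
Proof.
move=> hs hQ.
(* A failure raises the pointer, which never exceeds [t + t]; a success lowers
   the number of agents. *)
pose measure (s : state) := s 7 0 * (t + t).+1 + (t + t - s 8 0).
pose Inv v s := main_inv s /\ measure s = v.
apply: (@ok_while _ _ w_gt0 Inv _ _ (measure s)) => //.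
- apply: leq_trans iterations_le; rewrite leq_add ?leq_subr //.
  by rewrite leq_mul2r (env_m (main_env hs)) orbT.
- move=> v s1 [h1 <-] /=; rewrite -lt0n => m0.
  apply: ok_step; first exact: main_env h1.
    move=> s2 hf; have [pt h2] := failed_inv h1 m0 hf.
    exists (measure s2) => //; case: hf => h e8 _.
    by rewrite /measure h // e8; lia.
  move=> s2 u hu; have h2 := served_inv h1 m0 hu.
  exists (measure s2) => //; case: hu => _ _ [e7 _ _] _ _.
  by rewrite /measure e7; case: (s1 7 0) m0 => // m _; lia.
- move=> v s1 [h1 _] /= m0; apply: hQ; first exact: main_owner h1.
  move=> i beta lt_in hf.
  have si : s1 6 i != 0.
    apply/negP => /eqP si; have := active_gt0 lt_in si.
    by rewrite -(main_active h1) m0.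
  apply: (leq_trans (main_served h1 lt_in si hf)); rewrite leq_mul2l /=.
  (* Leftover copies go to agent 0 by default, which can only raise the value of a bundle. *)
  apply: bundle_value_le => j _; apply: leq_sum => c _.
  by case: (s1 5 j <= c).
Qed.

End Memory.

(** * Initialisation *)

Lemma ok_init N w n t (cp den : nat -> nat) s (Q : state -> Prop) :
    let K := \sum_(j < t) cp j in
    0 < w -> t <= N -> n * K <= N ->
    t < 2 ^ w -> n < 2 ^ w -> K < 2 ^ w -> n * K < 2 ^ w ->
    (forall x, x <= n * K -> \prod_(i < x) den i < 2 ^ w) ->
    s 0 0 = n -> s 0 1 = t -> s 1 =1 cp -> s 3 =1 den ->
    (forall y, 4 <= y -> s y =1 fun=> 0) ->
    (forall s', same [:: 5; 7; 9; 10; 11; 12] s s' ->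
      (forall j, j < t -> s' 5 j = cp j) -> s' 9 0 = K ->
      s' 10 0 = \prod_(i < n * K) den i ->
      s' 7 0 = (if K == 0 then 0 else n) -> Q s') ->
  ok N w init_cmd s Q.
Proof.
move=> K w0 tN nKN tw nw Kw nKw Dw e00 e01 e1 e3 e4 hQ.
have cpK j : j < t -> \sum_(j' < j.+1) cp j' <= K.
  move=> jt; rewrite /K -(subnKC jt) [X in _ <= X]big_split_ord /=.
  exact: leq_addr.
pose Inv1 j (s' : state) := [/\ same [:: 5; 7; 9; 10; 11; 12] s s',
  forall j', j' < j -> s' 5 j' = cp j', s' 9 0 = \sum_(j' < j) cp j',
  s' 10 0 = 0 & s' 7 0 = 0].
apply: ok_seq; apply: (@ok_for _ _ Inv1 _ _ _ t) => //.
- split; rewrite /update //= ?big_ord0 ?e4 //.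
  exact: same_update.
- by move=> j s1 _ _ [h _ _ _ _] /=; rewrite h.
- move=> j s1 jt sj [h h5 h9 h10 h7]; have := cpK j jt.
  rewrite big_ord_recr /= => le_K.
  apply: ok_seq; apply: (@ok_assign _ _ w0); [rewrite /= ?sj h // e1|].
    by apply: leq_ltn_trans Kw; apply: leq_trans le_K; apply: leq_addl.
  apply: (@ok_assign _ _ w0); rewrite /= /update /= ?sj (h 1) // e1 h9.
    exact: leq_ltn_trans Kw.
  split=> //; split; rewrite /update //=.
  + by do 3 apply: same_update => //.
  + move=> j' ; rewrite ltnS leq_eqVlt; case: eqVneq => [-> //|_] /=.
    exact: h5.
  + by rewrite big_ord_recr.
move=> s1 _ [h h5 h9 h10 h7].
apply: ok_seq; apply: (@ok_assign _ _ w0) => /=.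
  by rewrite -{1}(expn0 2) ltn_exp2l.
pose Inv2 x (s' : state) := [/\ same [:: 5; 7; 9; 10; 11; 12] s s',
  forall j', j' < t -> s' 5 j' = cp j', s' 9 0 = K,
  s' 10 0 = \prod_(i < x) den i & s' 7 0 = 0].
apply: ok_seq; apply: (@ok_for _ _ Inv2 _ _ _ (n * K)) => //.
- split; rewrite /update //= ?big_ord0 //.
  by do 2 apply: same_update => //.
- by move=> x s2 _ _ [h' _ h9' _ _] /=; rewrite h' // e00 h9'.
- move=> x s2 xn sx [h' h5' h9' h10' h7'].
  have pE : \prod_(i < x) den i * den x = \prod_(i < x.+1) den i.
    by rewrite big_ord_recr.
  apply: (@ok_assign _ _ w0); [rewrite /= sx h10' h' // e3 pE; exact: Dw|].
  rewrite /= sx h10' h' // e3 pE.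
  split=> //; split; rewrite /update //=.
  by do 2 apply: same_update => //.
move=> s2 _ [h' h5' h9' h10' h7'].
apply: (@ok_if _ _ w0) => /=; rewrite h9' => hK.
  apply: (@ok_assign _ _ w0) => /=; rewrite h' // e00 //.
  apply: hQ; rewrite /update //= ?(negPf hK) //.
  exact: same_update.
by apply: ok_skip; apply: hQ => //; rewrite hK eqxx.
Qed.

(** * Bit lengths and flattened lists *)

Lemma ltn_bitlen m : m < 2 ^ bitlen m.
Proof. exact: trunc_log_ltn. Qed.

Lemma bitlen_sum_nth (r : seq nat) a : nth 0 r a < 2 ^ (\sum_(m <- r) bitlen m).+1.
Proof.
elim: r a => [|m r IH] a; first by rewrite nth_nil expn_gt0.
rewrite big_cons -addnS expnD; case: a => [|a] /=.
  by rewrite (leq_trans (ltn_bitlen m)) // leq_pmulr // expn_gt0.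
by rewrite (leq_trans (IH a)) // leq_pmull // expn_gt0.
Qed.

Lemma size_le_bitlen (r : seq nat) : size r <= \sum_(m <- r) bitlen m.
Proof. by elim: r => [|m r IH]; rewrite ?big_cons //= -add1n leq_add. Qed.

Lemma prod_le_bitlen (r : seq nat) x :
  x <= size r -> \prod_(i < x) nth 0 r i <= 2 ^ \sum_(m <- r) bitlen m.
Proof.
elim: r x => [|m r IH] [|x] //= hx; rewrite ?big_ord0 ?expn_gt0 //.
rewrite big_ord_recl big_cons expnD leq_mul //=; first exact/ltnW/ltn_bitlen.
exact: IH.
Qed.

Lemma sum_nth_take (r : seq nat) j : \sum_(i < j) nth 0 r i = sumn (take j r).
Proof.
elim: r j => [|x r IH] [|j] /=; rewrite ?big_ord0 //.
  by rewrite big1 // => i _; rewrite nth_nil.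
by rewrite big_ord_recl /= IH.
Qed.

Lemma nth_flatten_index (T : Type) (x0 : T) (ss : seq (seq T)) r c :
    c < size (nth [::] ss r) ->
  nth x0 (flatten ss) (flatten_index (shape ss) r c) = nth x0 (nth [::] ss r) c.
Proof.
move=> hc; have rs : r < size ss.
  by rewrite ltnNge; apply: contraL hc => h; rewrite nth_default.
have hc' : c < nth 0 (shape ss) r by rewrite (nth_map [::]).
by rewrite nth_flatten flatten_indexKl // flatten_indexKr.
Qed.

(** * Instances and their encoding *)

Section Instance.

Variable I : splc_instance.

Definition icopies (j : nat) : nat := nth 0 (nth [::] (input I) 1) j.
Definition inum (x : nat) : nat := nth 0 (nth [::] (input I) 2) x.
Definition iden (x : nat) : nat := nth 0 (nth [::] (input I) 3) x.
Definition igoods : nat := \sum_(j < types I) icopies j.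
Definition idenominator : nat := \prod_(x < agents I * igoods) iden x.
Definition ivalue : nat -> nat -> nat -> nat :=
  copy_value igoods idenominator icopies inum iden.

Lemma icopiesE (j : 'I_(types I)) : icopies j = copies j.
Proof. by rewrite /icopies /= (nth_map j) ?size_enum_ord // nth_ord_enum. Qed.

Lemma icopies_out j : types I <= j -> icopies j = 0.
Proof. by move=> h; rewrite /icopies nth_default //= size_map size_enum_ord. Qed.

Lemma offset_take j :
  offset icopies j = sumn (take j [seq copies j | j <- enum 'I_(types I)]).
Proof. exact: sum_nth_take. Qed.

Lemma igoods_sumn : igoods = sumn [seq copies j | j <- enum 'I_(types I)].
Proof.
rewrite /igoods -/(offset _ _) offset_take take_oversize //.
by rewrite size_map size_enum_ord.
Qed.

Lemma good_indexE (j : 'I_(types I)) (c : 'I_(copies j)) :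
  good_index (Tagged (fun j => 'I_(copies j)) c) = offset icopies j + c.
Proof. by rewrite /good_index /flatten_index offset_take. Qed.

Definition value_row (i : 'I_(agents I)) : seq rat :=
  flatten [seq [seq value i j c | c <- iota 0 (copies j)]
          | j <- enum 'I_(types I)].

Lemma value_listE : value_list I = flatten [seq value_row i | i <- enum 'I_(agents I)].
Proof. by []. Qed.

Lemma shape_row (i : 'I_(agents I)) :
  shape [seq [seq value i j c | c <- iota 0 (copies j)] | j <- enum 'I_(types I)]
  = [seq copies j | j <- enum 'I_(types I)].
Proof.
rewrite /shape -map_comp; apply: eq_map => j /=.
by rewrite size_map size_iota.
Qed.

Lemma size_row i : size (value_row i) = igoods.
Proof. by rewrite size_flatten shape_row igoods_sumn. Qed.

Lemma shape_rows :
  shape [seq value_row i | i <- enum 'I_(agents I)] = nseq (agents I) igoods.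
Proof.
rewrite /shape; apply: (@eq_from_nth _ 0); first by rewrite 2!size_map size_enum_ord size_nseq.
move=> i; rewrite 2!size_map size_enum_ord => lt_i.
rewrite nth_nseq lt_i -map_comp (nth_map (Ordinal lt_i)) ?size_enum_ord //=.
exact: size_row.
Qed.

Lemma size_value_list : size (value_list I) = agents I * igoods.
Proof. by rewrite value_listE size_flatten shape_rows sumn_nseq mulnC. Qed.

Lemma index_lt (i : 'I_(agents I)) (j : 'I_(types I)) c : c < copies j ->
  i * igoods + (offset icopies j + c) < agents I * igoods.
Proof.
move=> hc; have h : offset icopies j + c < igoods.
  apply: (@leq_trans (offset icopies j.+1)).
    by rewrite offsetS ltn_add2l icopiesE.
  by apply: (@offset_leK _ igoods).
apply: (@leq_trans (i.+1 * igoods)); last by rewrite leq_mul2r ltn_ord orbT.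
by rewrite mulSnr ltn_add2l.
Qed.

Lemma nth_value_list (i : 'I_(agents I)) (j : 'I_(types I)) c : c < copies j ->
  nth 0%R (value_list I) (i * igoods + (offset icopies j + c)) = value i j c.
Proof.
move=> hc.
have row_j x0 : nth x0 [seq [seq value i j c | c <- iota 0 (copies j)]
    | j <- enum 'I_(types I)] j = [seq value i j c | c <- iota 0 (copies j)].
  by rewrite (nth_map j) ?size_enum_ord // nth_ord_enum.
have row_i x0 : nth x0 [seq value_row i | i <- enum 'I_(agents I)] i = value_row i.
  by rewrite (nth_map i) ?size_enum_ord // nth_ord_enum.
have e1 : i * igoods + (offset icopies j + c) = flatten_index
    (shape [seq value_row i | i <- enum 'I_(agents I)]) i (offset icopies j + c).
  rewrite /flatten_index shape_rows; congr (_ + _).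
  by rewrite take_nseq ?sumn_nseq 1?mulnC // ltnW.
have e2 : offset icopies j + c = flatten_index
    (shape [seq [seq value i j c | c <- iota 0 (copies j)]
           | j <- enum 'I_(types I)]) j c.
  by rewrite /flatten_index shape_row offset_take.
rewrite e1 value_listE nth_flatten_index row_i; last first.
  rewrite size_row; apply: (@leq_trans (offset icopies j.+1)).
    by rewrite offsetS ltn_add2l icopiesE.
  by apply: (@offset_leK _ igoods).
rewrite e2 /value_row nth_flatten_index row_j ?size_map ?size_iota //.
by rewrite (nth_map 0) ?size_iota // nth_iota.
Qed.

Lemma iden_gt0 x : x < agents I * igoods -> 0 < iden x.
Proof.
move=> hx; rewrite /iden /= (nth_map 0%R) ?size_value_list //.
by rewrite absz_gt0 denq_neq0.
Qed.

Lemma idenominator_gt0 : 0 < idenominator.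
Proof. by rewrite prodn_cond_gt0 // => x _; apply: iden_gt0. Qed.

Lemma ivalueE (i : 'I_(agents I)) (j : 'I_(types I)) c : c < copies j ->
  ((ivalue i j c)%:R = value i j c * idenominator%:R)%R.
Proof.
move=> hc; rewrite /ivalue /copy_value icopiesE hc /int_value.
have hx := index_lt i hc; set x := i * igoods + _ in hx *.
(* The denominator is a factor of the common one, so the integer division in [int_value] is
   exact. *)
have dvd : iden x %| idenominator.
  by rewrite /idenominator (bigD1 (Ordinal hx)) //= dvdn_mulr.
have dE : (idenominator%:R = (idenominator %/ iden x)%:R * (iden x)%:R :> rat)%R.
  by rewrite -natrM divnK.
have q : nth 0%R (value_list I) x = value i j c by apply: nth_value_list.
rewrite dE natrM /inum /iden /= !(nth_map 0%R) ?size_value_list // q.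
have n0 : (0 <= numq (value i j c))%R by rewrite numq_ge0 value_ge0.
rewrite !natr_absz (ger0_norm n0) (gtr0_norm (denq_gt0 _)) numqE.
by rewrite -mulrA [(_%:R * _)%R]mulrC.
Qed.

Lemma ivalue_noninc i : i < agents I -> forall j c c', c <= c' ->
  ivalue i j c' <= ivalue i j c.
Proof.
move=> lt_i j c c' cc'; rewrite {1}/ivalue /copy_value.
case: ifP => // hc'; have lt_j : j < types I.
  by rewrite ltnNge; apply: contraL hc' => /icopies_out ->.
have := hc'; rewrite (icopiesE (Ordinal lt_j)) => hk.
have -> : int_value igoods idenominator inum iden i (offset icopies j + c') =
    ivalue i j c' by rewrite /ivalue /copy_value hc'.
rewrite -(ler_nat rat) (ivalueE (Ordinal lt_i) (j := Ordinal lt_j)) //.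
rewrite (ivalueE (Ordinal lt_i) (j := Ordinal lt_j) (leq_ltn_trans cc' hk)).
by rewrite ler_wpM2r ?ler0n // value_noninc.
Qed.

Lemma card_goods (S : {set good I}) (j : 'I_(types I)) :
  #|S :&: goods_of_type j| =
  \sum_(c < copies j) (Tagged (fun j => 'I_(copies j)) c \in S).
Proof.
transitivity (\sum_(i | i == j) \sum_(c < copies i)
    (Tagged (fun j => 'I_(copies j)) c \in S)); last by rewrite big_pred1_eq.
rewrite sig_big_dep -sum1_card /=.
under eq_bigl => g do rewrite !inE andbC.
rewrite big_mkcondr /=; apply: eq_big => [g|[g c] _] /=; first by rewrite andbT.
by case: ifP.
Qed.

Definition bundle_count (S : {set good I}) (j : nat) : nat :=
  if insub j is Some j' then #|S :&: goods_of_type (j' : 'I_(types I))| else 0.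

Lemma bundle_countE S (j : 'I_(types I)) :
  bundle_count S j = #|S :&: goods_of_type j|.
Proof. by rewrite /bundle_count valK. Qed.

Lemma bundle_count_le S (j : 'I_(types I)) : bundle_count S j <= copies j.
Proof.
rewrite bundle_countE card_goods -[X in _ <= X]card_ord -sum1_card.
by apply: leq_sum => c _; case: (_ \in _).
Qed.

Lemma valuationE (i : 'I_(agents I)) S :
  (valuation i S * idenominator%:R =
   (bundle_value (types I) (ivalue i) (bundle_count S))%:R)%R.
Proof.
rewrite /valuation /bundle_value mulr_suml natr_sum; apply: eq_bigr => j _.
rewrite bundle_countE mulr_suml natr_sum; apply: eq_bigr => c _.
rewrite ivalueE // (leq_trans (ltn_ord c)) // -bundle_countE.
exact: bundle_count_le.
Qed.

Lemma allocation_feasible (A : {ffun 'I_(agents I) -> {set good I}}) i beta :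
    is_allocation A ->
    (forall l, beta <= bundle_value (types I) (ivalue i) (bundle_count (A l))) ->
  feasible (types I) (ivalue i) beta (agents I) icopies.
Proof.
move=> /andP[/forallP disj _] hb; exists (fun l => bundle_count (A l)); split=> //.
move=> j jt; rewrite (icopiesE (Ordinal jt)).
under eq_bigr => l _ do rewrite (bundle_countE _ (Ordinal jt)) card_goods.
rewrite exchange_big /= -[X in _ <= X]card_ord -sum1_card.
apply: leq_sum => c _; set g : good I := Tagged _ _.
case: (pickP (fun l => g \in A l)) => [l gl|none]; last first.
  by rewrite big1 // => l _; rewrite none.
rewrite (bigD1 l) //= gl big1 // => l' l'l.
have := disj l'; move/forallP/(_ l); rewrite l'l /= => /pred0P/(_ g) /=.
by rewrite gl andbT => ->.
Qed.

(** By integrality, if some allocation gave every part more than twice the value of [S], then one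
    more than twice the scaled value of [S] would be feasible, against the hypothesis. *)
Lemma mms_le (i : 'I_(agents I)) (S : {set good I}) :
    (forall beta, feasible (types I) (ivalue i) beta (agents I) icopies ->
       beta <= 2 * bundle_value (types I) (ivalue i) (bundle_count S)) ->
  (1 / 2 * mms i <= valuation i S)%R.
Proof.
move=> h; have d0 : (0 < idenominator%:R :> rat)%R.
  by rewrite ltr0n idenominator_gt0.
have v0 : (0 <= valuation i S)%R.
  by rewrite -(pmulr_lge0 _ d0) valuationE ler0n.
rewrite mul1r mulrC ler_pdivrMr ?ltr0n //.
apply: bigmax_le => [|A alloc]; first by rewrite mulr_ge0 // ler0n.
rewrite leNgt; apply/negP => lt_min.
pose beta := (2 * bundle_value (types I) (ivalue i) (bundle_count S)).+1.
suff /h : feasible (types I) (ivalue i) beta (agents I) icopies.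
  by rewrite ltnn.
apply: (allocation_feasible alloc) => l.
have : (valuation i S * 2 < valuation i (A l))%R.
  by apply: (lt_le_trans lt_min); apply: bigmin_le_cond.
rewrite -(ltr_pM2r d0) mulrAC !valuationE -natrM ltr_nat.
by rewrite mulnC.
Qed.

Lemma output_allocation s : (forall x, s 4 x < agents I) ->
  is_allocation (output I s).
Proof.
move=> hs; apply/andP; split.
  apply/forallP => i; apply/forallP => i'; apply/implyP => ne.
  rewrite -setI_eq0; apply/eqP/setP => g; rewrite !ffunE !inE.
  apply/negP => /andP[/eqP -> /eqP e]; case/eqP: ne; exact: val_inj.
apply/eqP/setP => g; rewrite inE; apply/bigcupP.
by exists (Ordinal (hs (good_index g))); rewrite // ffunE inE.
Qed.

Lemma bundle_count_output s (i : 'I_(agents I)) (j : 'I_(types I)) :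
  bundle_count (output I s i) j =
  \sum_(c < icopies j) (s 4 (offset icopies j + c) == i).
Proof.
rewrite bundle_countE card_goods icopiesE; apply: eq_bigr => c _.
by rewrite ffunE inE good_indexE.
Qed.

End Instance.

(** * Bounds by the size of the input *)

Section Bounds.

Variable I : splc_instance.
Local Notation L := (input_size I).

Lemma input_part_le k : \sum_(m <- nth [::] (input I) k) bitlen m <= L.
Proof.
rewrite /input_size; elim: (input I) k => [|r rs IH] [|k] /=;
  rewrite ?big_nil ?big_cons ?leq_addr //.
exact: leq_trans (IH k) (leq_addl _ _).
Qed.

Lemma input_state_lt x a : input_state I x a < 2 ^ L.+1.
Proof.
apply: leq_trans (bitlen_sum_nth _ a) _.
by rewrite leq_exp2l // ltnS input_part_le.
Qed.

Lemma input_size_gt0 : 0 < L.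
Proof. by rewrite /input_size !big_cons. Qed.

Lemma types_le : types I <= L.
Proof.
apply: leq_trans (input_part_le 1); apply: leq_trans (size_le_bitlen _).
by rewrite /= size_map size_enum_ord.
Qed.

(** The input lists one numerator per agent and copy, and each takes at least one bit. *)
Lemma cells_le : agents I * igoods I <= L.
Proof.
apply: leq_trans (input_part_le 2); apply: leq_trans (size_le_bitlen _).
by rewrite /= size_map size_value_list.
Qed.

Lemma igoods_le : igoods I <= L.
Proof. exact: leq_trans (leq_pmull _ (agents_gt0 I)) cells_le. Qed.

Lemma agents_le : 0 < igoods I -> agents I <= L.
Proof. by move=> K0; apply: leq_trans (leq_pmulr _ K0) cells_le. Qed.

Lemma iden_prod_le x : x <= agents I * igoods I ->
  \prod_(i < x) iden I i <= 2 ^ L.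
Proof.
move=> hx; apply: leq_trans (prod_le_bitlen _) _.
  by rewrite /= size_map size_value_list.
by rewrite leq_exp2l // (input_part_le 3).
Qed.

End Bounds.

(** The main loop runs at most [n * (2 * t + 1) + 2 * t] times, which is at most [5 * L ^ 2] as [n]
    and [t] are at most [L] when there are goods. The word length [5 * L] accommodates the sums of
    scaled values. *)
Lemma ok_splc I (L := input_size I) :
  ok (5 * L ^ 2) (5 * L) splc_cmd (input_state I) (fun s =>
    is_allocation (output I s) /\
    forall i, (1 / 2 * mms i <= valuation i (output I s i))%R).
Proof.
have L0 : 0 < L := input_size_gt0 I.
have n0 := agents_gt0 I.
have LY : L < 2 ^ L by apply: ltn_expl.
have Yw : 2 ^ (L + 4) <= 2 ^ (5 * L) by rewrite leq_exp2l //; lia.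
have nY : agents I < 2 ^ L.+1 by apply: (input_state_lt I 0 0).
have [[tL KL] nKL] := (types_le I, igoods_le I, cells_le I).
rewrite -/L in tL KL nKL.
have Y16 : 2 ^ (L + 4) = 16 * 2 ^ L by rewrite expnD mulnC.
rewrite expnS in nY.
have LN : L <= 5 * L ^ 2 by rewrite expnS expn1; nia.
have w0 : 0 < 5 * L by lia.
rewrite /splc_cmd; apply: ok_seq.
apply: (@ok_init _ _ (agents I) (types I) (icopies I) (iden I)) => //.
- exact: leq_trans tL LN.
- exact: leq_trans nKL LN.
- lia.
- lia.
- change (igoods I < 2 ^ (5 * L)); lia.
- change (agents I * igoods I < 2 ^ (5 * L)); lia.
- by move=> x hx; apply: leq_ltn_trans (iden_prod_le hx) _; rewrite -/L; lia.
- by move=> y hy x; rewrite /input_state (nth_default [::]) ?nth_nil.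
rewrite -/(igoods I) => s h h5 h9 h10 h7.
have s4 x : s 4 x = 0 by rewrite h // /input_state nth_nil.
(* Without goods the loop is skipped, and every feasible [beta] is 0. *)
have [K0|K0] := posnP (igoods I).
  rewrite K0 eqxx in h7.
  apply: (@ok_while _ _ w0 (fun _ s' => s' = s) _ _ 0) => //=.
    by move=> v _ ->; rewrite h7.
  move=> _ s' -> _; split; first by apply: output_allocation => x; rewrite s4.
  move=> i; apply: mms_le => beta hf.
  have := feasible_proportional (ivalue_noninc (ltn_ord i)) hf.
  rewrite /proportional big1 ?leqn0 ?muln_eq0.
    by case/orP => /eqP e; [rewrite e in n0 | rewrite e].
  move=> j _; move/eqP: K0; rewrite sum_nat_eq0 => /forallP/(_ j)/eqP ->.
  by rewrite /balanced big_ord0.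
rewrite (gtn_eqF K0) in h7.
have nL := agents_le K0; rewrite -/L in nL.
have t0 : 0 < types I.
  by move: K0; rewrite /igoods; case: (types I) => //; rewrite big_ord0.
apply: (@ok_main _ _ (agents I) (types I) (igoods I) (idenominator I)
  (2 ^ L.+1 * 2 ^ L) (icopies I) (inum I) (iden I)) => //.
- move=> i x; apply: leq_mul; first exact/ltnW/(input_state_lt I 2).
  by rewrite (leq_trans (leq_div _ _)) // iden_prod_le.
- exact: leq_trans nL LN.
- exact: leq_trans tL LN.
- exact: leq_trans KL LN.
(* The exponents add up to [4 * L + 1], which is at most [5 * L]. *)
- apply: (@leq_trans (2 ^ L * (2 ^ L * (2 ^ L.+1 * 2 ^ L)))).
    have P : 0 < 2 ^ L.+1 * 2 ^ L by rewrite muln_gt0 !expn_gt0.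
    apply: (@leq_ltn_trans (L * (L * (2 ^ L.+1 * 2 ^ L)))).
      by rewrite !leq_mul.
    by apply: ltn_mul => //; rewrite ltn_pmul2r.
  by rewrite -!expnD leq_exp2l //; lia.
- lia.
- exact: ivalue_noninc.
- by rewrite expnS expn1; nia.
- split.
  + split; try by [exact: h9|exact: h10|rewrite h|move=> x; rewrite h].
    * by move=> j jt; rewrite h5.
    * by rewrite h7.
  + rewrite h7 /active -[LHS]card_ord -sum1_card; apply: eq_bigr => i _.
    by rewrite h // /input_state nth_nil.
  + move=> i beta lt_in _ hf; rewrite h7 (h 8) //.
    apply: (@pointer_inv_eq _ _ _ _ (icopies I)) => [j jt|]; first by rewrite h5.
    exact: pointer_inv0.
  + by move=> i beta _; rewrite h // /input_state nth_nil.
  + by move=> x; rewrite s4.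
- move=> s' h4 hb; split; first exact: output_allocation.
  move=> i; apply: mms_le => beta hf.
  apply: leq_trans (hb i beta (ltn_ord i) hf) _; rewrite leq_mul2l /=.
  apply: bundle_value_le => j jt.
  by rewrite -(bundle_count_output s' i (Ordinal jt)).
Qed.

Local Open Scope ring_scope.

Theorem theorem4p2 :
  exists (p : cmd) (a d : nat), forall I : splc_instance,
    exists (T : nat) (s : state),
      [/\ exec p (input_state I) T s,
          (T <= a * input_size I ^ d)%N,
          is_allocation (output I s) &
          forall i : 'I_(agents I),
            1 / 2 * mms i <= valuation i (output I s i)].
Proof.
(* Taking [l] as the predecessor of the positive input size turns powers of [l.+1] into powers of
   the size itself. *)
have [|l|a [d h]] :=
  @time_bound_poly (fun l => 5 * l.+1 ^ 2)%N (fun l => 5 * l.+1)%N 5 2 5 1 splc_cmd.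
- by [].
- by rewrite expn1.
exists splc_cmd, a, d => I.
have L0 := input_size_gt0 I.
have bnd : bounded (5 * input_size I) (input_state I).
  move=> x b; apply: leq_trans (input_state_lt _ _ _) _.
  by rewrite leq_exp2l //; lia.
have [T [s [h1 h2 _ [h3 h4]]]] := ok_splc bnd.
exists T, s; split=> //; apply: (leq_trans h2).
by have := h (input_size I).-1; rewrite prednK.
Qed.
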